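(* Let $K$ be a Mrówka space (in particular a compact scattered Hausdorff space) such that: (i) the ideal $\mathscr{X}(C(K))$ has codimension one in $\mathscr{B}(C(K))$; (ii) each separable subspace of $C(K)$ is contained in a subspace isomorphic to $c_0$; (iii) if $C(K)=A\oplus B$ is a decomposition into two closed, infinite-dimensional subspaces $A$ and $B$, then either $A\cong c_0$ and $B\cong C(K)$, or vice versa. Then the lattice of closed ideals in $\mathscr{B}(C(K))$ has the form $$\{0\}\subsetneq\mathscr{K}(C(K))\subsetneq\mathscr{X}(C(K))=\mathscr{G}_{c_0}(C(K))=\mathscr{WCG}(C(K))\subsetneq\mathscr{B}(C(K)),$$ that is, the indicated inclusions and equalities hold and these are all the closed two-sided ideals of $\mathscr{B}(C(K))$.
   Context: A Mrówka space is the Stone space of the Boolean subalgebra of $\mathscr{P}(\mathbb{N})$ generated by an uncountable family of almost disjoint (infinite) subsets of $\mathbb{N}$ (distinct members have finite intersection) together with all finite subsets of $\mathbb{N}$. Koszmider constructed a Mrówka space $K$ with properties (i)–(iii), assuming the continuum hypothesis or Martin's Axiom together with the negation of the continuum hypothesis. For a Banach space $X$, inside $\mathscr{B}(X)$ (bounded operators): $\mathscr{K}(X)$ is the ideal of compact operators; $\mathscr{X}(X)$ is the ideal of operators with separable range; $\mathscr{G}_{c_0}(X)=\{ST\colon T\in\mathscr{B}(X,c_0),\ S\in\mathscr{B}(c_0,X)\}$ is the ideal of operators factoring through $c_0$; $\mathscr{WCG}(X)$ is the ideal of operators whose range is contained in a closed subspace of $X$ that is weakly compactly generated (i.e. a Banach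 space containing a weakly compact subset with dense linear span). $\cong$ denotes isomorphism of Banach spaces. *)

(* Defs.v *)
From HB Require Import structures.
From mathcomp Require Import all_boot all_order all_algebra finmap complex.
From mathcomp Require Import boolp classical_sets functions cardinality.
From mathcomp Require Import reals topology normedtype.

Set Implicit Arguments.
Unset Strict Implicit.
Unset Printing Implicit Defensive.

Import Order.TTheory GRing.Theory Num.Theory.
Import numFieldNormedType.Exports.

Local Open Scope classical_set_scope.
Local Open Scope ring_scope.

Variant real_or_complex : numFieldType -> Prop :=
| RealScalars (R : realType) : real_or_complex R
| ComplexScalars (R : realType) : real_or_complex R[i].

(* The supremum is taken in the partial order of F: when F = R[i] the values
   `|f t| are nonnegative elements of R[i], as is their least upper bound. *)
Definition sup_norm (F : numFieldType) (T : Type) (f : T -> F^o) : F :=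
  supremum 0 (range (fun t => `|f t|)).

Section SupNormTheory.
Variables (F : numFieldType) (T : Type).
Implicit Types f g : T -> F^o.

Definition attains_max f :=
  (exists t0, forall t, `|f t| <= `|f t0|) \/ (T -> False).

Lemma sup_norm_max f t0 :
  (forall t, `|f t| <= `|f t0|) -> sup_norm f = `|f t0|.
Proof.
move=> ft0; rewrite /sup_norm /supremum; case: ifPn => [/eqP e|_].
  have : (range (fun t => `|f t|)) `|f t0| by exists t0.
  by rewrite e.
have s0 : supremums (range (fun t => `|f t|)) `|f t0|.
  by split=> [_ [t _ <-]//|r]; apply; exists t0.
case: xgetP => [r _ rs|/(_ _ s0)//].
by apply: (is_subset1_supremums rs s0).
Qed.

Lemma sup_norm_empty f : (T -> False) -> sup_norm f = 0.
Proof.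
move=> T0; rewrite /sup_norm /supremum; case: ifPn => // /eqP e.
by case: e; rewrite -subset0 => r [t _ _]; exact: (T0 t).
Qed.

Lemma le_sup_norm f t : attains_max f -> `|f t| <= sup_norm f.
Proof. by case=> [[t0 ft0]|/(_ t)[]]; rewrite (sup_norm_max ft0). Qed.

Lemma sup_normD f g : attains_max f -> attains_max g -> attains_max (f + g) ->
  sup_norm (f + g) <= sup_norm f + sup_norm g.
Proof.
move=> mf mg [[t0 fg]|T0]; last by rewrite !sup_norm_empty// addr0.
rewrite (sup_norm_max fg) (le_trans (ler_normD _ _))//.
by rewrite lerD// le_sup_norm.
Qed.

Lemma sup_normZ (a : F) f : attains_max f ->
  sup_norm (a *: f) = `|a| * sup_norm f.
Proof.
case=> [[t0 ft0]|T0]; last by rewrite !sup_norm_empty// mulr0.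
rewrite (sup_norm_max ft0) (@sup_norm_max _ t0) ?normrM// => t.
by rewrite !normrM ler_wpM2l.
Qed.

Lemma sup_norm0_eq0 f : attains_max f -> sup_norm f = 0 -> f = 0.
Proof.
move=> mf f0; apply/funext => t; apply/eqP.
by rewrite -normr_le0 -f0 le_sup_norm.
Qed.

End SupNormTheory.

HB.mixin Record isCompactSpace T & Topological T := {
  compact_setT : compact [set: T] }.

#[short(type="compactSpaceType")]
HB.structure Definition CompactSpace := { T of Topological T & isCompactSpace T }.

Section ContinuousFunctions.
Variables (K : compactSpaceType) (F : numFieldType).

Definition continuous_pred : {pred K -> F^o} := fun f => `[< continuous f >].

Lemma continuous_pred_submod : submod_closed continuous_pred.
Proof.
split=> [|a f g /asboolP cf /asboolP cg]; apply/asboolP => x.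
  exact: cvg_cst.
by apply: cvgD; [apply: cvgZr; exact: cf|exact: cg].
Qed.

HB.instance Definition _ := GRing.isSubmodClosed.Build F (K -> F^o)
  continuous_pred continuous_pred_submod.

Definition CK := {f : K -> F^o | continuous_pred f}.

HB.instance Definition _ := SubType.on CK.
HB.instance Definition _ := Choice.on CK.
HB.instance Definition _ := [SubChoice_isSubLmodule of CK by <:].

(* extreme value theorem, for an arbitrary numFieldType *)
Lemma CK_attains_max (f : CK) : attains_max (val f).
Proof.
have /asboolP cf := valP f.
have [K0|T0] := pselect (exists t : K, True); last first.
  by right=> t; apply: T0; exists t.
left; apply: contrapT => nmax.
have far t0 : exists t, `|val f t0| < `|val f t|.
  apply: contrapT => h; apply: nmax; exists t0 => t.
  have /orP[//|lt_t] := real_leVge (normr_real (val f t)) (normr_real (val f t0)).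
  have [->//|ne] := eqVneq `|val f t| `|val f t0|.
  by case: h; exists t; rewrite lt_neqAle eq_sym ne.
have cnf : continuous (fun t => `|val f t|).
  by move=> t; apply: cvg_norm; exact: cf.
pose U (s : K) := [set t : K | `|val f t| < `|val f s|].
have opU s : open (U s).
  rewrite openE => t ut; rewrite /interior.
  have d0 : 0 < `|val f s| - `|val f t| by rewrite subr_gt0.
  have : \forall t' \near t, `| val f t - val f t' | < `|val f s| - `|val f t|.
    by move: (cf t) => /cvgrPdist_lt; apply.
  apply: filterS => t' h; rewrite /U /= .
  rewrite -[X in `|X|](subrK (val f t)) (le_lt_trans (ler_normD _ _))//.
  by rewrite distrC -ltrBrDr.
pose G := filter_from setT (fun s : K => [set t | `|val f s| <= `|val f t|]).
have GF : ProperFilter G.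
  apply: filter_from_proper => [|s _]; last by exists s => /=.
  apply: filter_from_filter => [|s t _ _]; first by have [s _] := K0; exists s.
  have /orP[st|ts] := real_leVge (normr_real (val f s)) (normr_real (val f t)).
    by exists t => // u /= tu; split => //; exact: le_trans tu.
  by exists s => // u /= su; split => //; exact: le_trans su.
have [x [_ xG]] := @compact_setT K G GF filterT.
have [s xs] := far x.
have [||t [/= st ts]] := xG [set t | `|val f s| <= `|val f t|] (U s).
- by exists s.
- by apply: (@open_nbhs_nbhs K x (U s)); split; [exact: opU|exact: xs].
- by have := lt_le_trans ts st; rewrite ltxx.
Qed.

Let CK_normD (f g : CK) :
  sup_norm (val (f + g)) <= sup_norm (val f) + sup_norm (val g).
Proof.
exact: sup_normD (CK_attains_max f) (CK_attains_max g) (CK_attains_max (f + g)).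
Qed.

Let CK_normZ (a : F) (f : CK) :
  sup_norm (val (a *: f)) = `|a| * sup_norm (val f).
Proof. by apply: sup_normZ; exact: CK_attains_max. Qed.

Let CK_norm0 (f : CK) : sup_norm (val f) = 0 -> f = 0.
Proof. by move=> f0; apply: val_inj; apply: sup_norm0_eq0 f0; exact: CK_attains_max. Qed.

HB.instance Definition _ :=
  Lmodule_isNormed.Build F CK CK_normD CK_normZ CK_norm0.

End ContinuousFunctions.

Section NullSequences.
Variable F : numFieldType.

Definition null_pred : {pred nat -> F^o} :=
  fun u => `[< u n @[n --> \oo] --> (0 : F^o) >].

Lemma null_pred_submod : submod_closed null_pred.
Proof.
split=> [|a u v /asboolP cu /asboolP cv]; apply/asboolP; first exact: cvg_cst.
rewrite -[X in _ --> X](addr0 (0 : F^o)) -[X in _ --> X + _](scaler0 _ a).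
by apply: cvgD => //; exact: cvgZr.
Qed.

HB.instance Definition _ := GRing.isSubmodClosed.Build F (nat -> F^o)
  null_pred null_pred_submod.

Definition c0 := {u : nat -> F^o | null_pred u}.

HB.instance Definition _ := SubType.on c0.
HB.instance Definition _ := Choice.on c0.
HB.instance Definition _ := [SubChoice_isSubLmodule of c0 by <:].

Lemma c0_attains_max (u : c0) : attains_max (val u).
Proof.
left; have /asboolP cu := valP u.
have fin N : exists n0, forall n, (n < N.+1)%N -> `|val u n| <= `|val u n0|.
  elim: N => [|N [n0 ih]]; first by exists 0%N => -[].
  have /orP[st|ts] := real_leVge (normr_real (val u N.+1)) (normr_real (val u n0)).
    by exists n0 => n; rewrite ltnS leq_eqVlt => /predU1P[->//|]; exact: ih.
  exists N.+1 => n; rewrite ltnS leq_eqVlt => /predU1P[->//|/ih h].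
  exact: le_trans ts.
have [[m um]|u0] := pselect (exists m, val u m != 0); last first.
  exists 0%N => n; have [->|un] := eqVneq (val u n) 0; first by rewrite normr0.
  by case: u0; exists n.
have [N _ uN] : \forall n \near \oo, `|val u n| < `|val u m|.
  move/cvgrPdist_lt : cu => /(_ `|val u m|); rewrite normr_gt0 => /(_ um).
  by apply: filterS => n; rewrite sub0r normrN.
have [n0 h] := fin (maxn N m).
exists n0 => n; have [nN|Nn] := ltnP n (maxn N m).+1; first exact: h.
rewrite (@le_trans _ _ `|val u m|)//.
  by apply/ltW/uN => /=; rewrite (leq_trans (leq_maxl _ m))// ltnW.
by apply: h; rewrite ltnS leq_maxr.
Qed.

Let c0_normD (u v : c0) :
  sup_norm (val (u + v)) <= sup_norm (val u) + sup_norm (val v).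
Proof.
exact: sup_normD (c0_attains_max u) (c0_attains_max v) (c0_attains_max (u + v)).
Qed.

Let c0_normZ (a : F) (u : c0) :
  sup_norm (val (a *: u)) = `|a| * sup_norm (val u).
Proof. by apply: sup_normZ; exact: c0_attains_max. Qed.

Let c0_norm0 (u : c0) : sup_norm (val u) = 0 -> u = 0.
Proof.
by move=> u0; apply: val_inj; apply: sup_norm0_eq0 u0; exact: c0_attains_max.
Qed.

HB.instance Definition _ :=
  Lmodule_isNormed.Build F c0 c0_normD c0_normZ c0_norm0.

End NullSequences.

Record linear_subspace (F : numFieldType) (V : normedModType F) := Subspace {
  subspace_set :> set V;
  subspace0 : subspace_set 0;
  subspaceP : forall (a : F) x y,
    subspace_set x -> subspace_set y -> subspace_set (a *: x + y) }.

Section SubspaceNormed.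
Variables (F : numFieldType) (V : normedModType F) (A : linear_subspace V).

Definition subspace_pred : {pred V} := fun x => `[< subspace_set A x >].

Lemma subspace_pred_submod : submod_closed subspace_pred.
Proof.
split=> [|a x y /asboolP Ax /asboolP Ay]; apply/asboolP; first exact: subspace0.
exact: subspaceP.
Qed.

HB.instance Definition _ := GRing.isSubmodClosed.Build F V
  subspace_pred subspace_pred_submod.

Definition subspace_space := {x : V | subspace_pred x}.

HB.instance Definition _ := SubType.on subspace_space.
HB.instance Definition _ := Choice.on subspace_space.
HB.instance Definition _ := [SubChoice_isSubLmodule of subspace_space by <:].

Let subspace_normD (x y : subspace_space) :
  `|val (x + y)| <= `|val x| + `|val y|.
Proof. exact: ler_normD. Qed.

Let subspace_normZ (a : F) (x : subspace_space) :
  `|val (a *: x)| = `|a| * `|val x|.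
Proof. exact: normrZ. Qed.

Let subspace_norm0 (x : subspace_space) : `|val x| = 0 -> x = 0.
Proof. by move=> /normr0_eq0 x0; exact: val_inj. Qed.

HB.instance Definition _ := Lmodule_isNormed.Build F subspace_space
  subspace_normD subspace_normZ subspace_norm0.

End SubspaceNormed.

Definition linear_span (F : numFieldType) (V : lmodType F) (A : set V) : set V :=
  [set x | exists n (a : 'I_n -> F) (v : 'I_n -> V),
     (forall i, A (v i)) /\ x = \sum_(i < n) a i *: v i].

Definition infinite_dimensional (F : numFieldType) (V : lmodType F) :=
  ~ exists s : seq V, linear_span [set` s] = setT.

Definition direct_sum (F : numFieldType) (V : normedModType F)
    (A B : linear_subspace V) :=
  A `&` B = [set 0] /\
  forall x, exists a b, [/\ subspace_set A a, subspace_set B b & x = a + b].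

Definition separable (T : topologicalType) (A : set T) :=
  exists D : set T, [/\ countable D, D `<=` A & A `<=` closure D].

Definition bounded_ops (F : numFieldType) (X Y : normedModType F) :
    set (X -> Y) :=
  [set T | linear T /\ continuous T].

Arguments bounded_ops {F} X Y.

Definition isomorphic (F : numFieldType) (X Y : normedModType F) :=
  exists (T : X -> Y) (S : Y -> X),
    [/\ bounded_ops X Y T, bounded_ops Y X S, cancel T S & cancel S T].

Definition dual (F : numFieldType) (X : normedModType F) :=
  {phi : X -> F^o | bounded_ops X F^o phi}.

Definition weak_topology (F : numFieldType) (X : normedModType F) :
    topologicalType :=
  initial_topology
    ((fun x phi => sval phi x) : X -> prod_topology (fun _ : dual X => F^o)).

Definition weakly_compact (F : numFieldType) (X : normedModType F) (A : set X) :=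
  compact (A : set (weak_topology X)).

Definition weakly_compactly_generated (F : numFieldType) (X : normedModType F) :=
  exists A : set X, weakly_compact A /\ dense (linear_span A).

Section OperatorIdeals.
Variables (F : numFieldType) (X : normedModType F).

Definition compact_ops : set (X -> X) :=
  [set T | bounded_ops X X T /\ precompact (T @` [set x | `|x| <= 1])].

Definition separable_range_ops : set (X -> X) :=
  [set T | bounded_ops X X T /\ separable (range T)].

Definition c0_factoring_ops : set (X -> X) :=
  [set U | exists T S,
     [/\ bounded_ops X (c0 F) T, bounded_ops (c0 F) X S & U = S \o T]].

Definition wcg_ops : set (X -> X) :=
  [set T | bounded_ops X X T /\
     exists W : linear_subspace X, [/\ closed (W : set X), range T `<=` W &
       weakly_compactly_generated (subspace_space W)]].

(* the bound on T - S says that its operator norm is at most e *)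
Definition opnorm_closed (I : set (X -> X)) :=
  forall T, bounded_ops X X T ->
    (forall e : F, 0 < e ->
       exists2 S, I S & forall x, `|T x - S x| <= e * `|x|) -> I T.

Definition closed_ideal (I : set (X -> X)) :=
  [/\ I `<=` bounded_ops X X,
      [/\ I 0, (forall T S, I T -> I S -> I (T + S)) &
          forall a T, I T -> I (a *: T)],
      (forall T U V, I T -> bounded_ops X X U -> bounded_ops X X V ->
         I (U \o T \o V)) &
      opnorm_closed I].

Definition codimension_one (I : set (X -> X)) :=
  exists U, [/\ bounded_ops X X U, ~ I U &
    forall T, bounded_ops X X T -> exists a : F, I (T - a *: U)].

End OperatorIdeals.

Arguments compact_ops {F} X.
Arguments separable_range_ops {F} X.
Arguments c0_factoring_ops {F} X.
Arguments wcg_ops {F} X.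

Definition boolean_subalgebra (T : Type) (B : set (set T)) :=
  [/\ B setT, (forall A C, B A -> B C -> B (A `&` C)) &
      forall A, B A -> B (~` A)].

Record ultrafilter_of (T : Type) (B u : set (set T)) : Prop := UltrafilterOf {
  uf_sub : u `<=` B;
  uf_setT : u setT;
  uf_set0 : ~ u set0;
  uf_setI : forall A C, u A -> u C -> u (A `&` C);
  uf_up : forall A C, u A -> B C -> A `<=` C -> u C;
  uf_ultra : forall A, B A -> u A \/ u (~` A) }.

(* meant for B a Boolean subalgebra; the sets {u | A \in u} with A in B form
   a base, since ultrafilters are closed under intersection *)
Definition stone_space (T : Type) (B : set (set T)) :=
  {u : set (set T) | ultrafilter_of B u}.

Section StoneSpace.
Variables (T : Type) (B : set (set T)).

HB.instance Definition _ := gen_eqMixin (stone_space B).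
HB.instance Definition _ := gen_choiceMixin (stone_space B).
HB.instance Definition _ := isSubBaseTopological.Build (stone_space B)
  B (fun A => [set u : stone_space B | sval u A]).

Lemma stone_space_compact : compact [set: stone_space B].
Proof.
rewrite compact_ultra => G GU _.
pose has A := [set v : stone_space B | sval v A].
have gmem : exists v : stone_space B, True.
  by have [v _] := filter_ex (@filterT _ G _); exists v.
have GW P : G P -> exists v, P v.
  by move=> GP; have [v Pv] := filter_ex GP; exists v.
pose u := [set A | B A /\ G (has A)].
have uu : ultrafilter_of B u.
  split.
  - by move=> A [].
  - have [v _] := gmem; split; first exact: (uf_sub (svalP v)) (uf_setT (svalP v)).
    by apply: filterS filterT => w _; exact: uf_setT (svalP w).
  - by move=> [_ /GW[v]]; exact: uf_set0 (svalP v).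
  - move=> A C [BA GA] [BC GC]; have GAC : G (has (A `&` C)).
      by apply: filterS (filterI GA GC) => w [wA wC]; exact: uf_setI (svalP w) _ _ wA wC.
    by split=> //; have [v vAC] := GW _ GAC; exact: uf_sub (svalP v) _ vAC.
  - move=> A C [BA GA] BC AC; split=> //.
    by apply: filterS GA => w wA; exact: uf_up (svalP w) _ _ wA BC AC.
  - move=> A BA; have [GA|GA] := in_ultra_setVsetC (has A) GU; first by left.
    have GcA : G (has (~` A)).
      by apply: filterS GA => w nwA; have [|] := uf_ultra (svalP w) BA.
    right; split=> //; have [v vA] := GW _ GcA; exact: uf_sub (svalP v) _ vA.
exists (exist _ u uu : stone_space B); split=> // U.
rewrite nbhsE => -[V [[D' D'B <-] [i D'i /= iu]] VU].
apply: filterS VU _; apply: filterS (bigcup_sup D'i) _.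
have [E EB Ei] := D'B _ D'i; rewrite -{}Ei in iu *.
apply: filter_bigI => A AE; by have [] := iu _ AE.
Qed.

HB.instance Definition _ := isCompactSpace.Build (stone_space B)
  stone_space_compact.

End StoneSpace.

Definition almost_disjoint (A : set (set nat)) :=
  (forall a, A a -> infinite_set a) /\
  (forall a b, A a -> A b -> a <> b -> finite_set (a `&` b)).

Definition mrowka_space (A : set (set nat)) : compactSpaceType :=
  stone_space (smallest (@boolean_subalgebra nat) (A `|` finite_set)).

(* Main.v *)
From HB Require Import structures.
Require Import Defs.
From mathcomp Require Import finmap.
From mathcomp Require Import all_boot all_order all_algebra complex.
From mathcomp Require Import boolp classical_sets functions cardinality.
From mathcomp Require Import reals topology normedtype.
From mathcomp Require Import ring.

(* Three ingredients give the classification.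

   (1) The identity of c_0 factors approximately through every non-compact
   operator T on X = C(K).  A bounded sequence on which T is separated spans a
   separable subspace, which by (ii) lies in a copy of c_0; restricting T to it
   gives a non-compact operator tau : c_0 -> X.  Non-compactness yields disjointly
   supported normalized u_k and integers t_k -> oo with |tau u_k (t_k)| >= d.
   Every sequence in N has a subsequence converging to some q in K, so
   f |-> f(t_k) - f(q) is weak* null, and after a further (gliding hump)
   extraction these functionals are almost biorthogonal to tau u_k.  An operator
   with separable range factors through c_0 by (ii), so it lies in every closed
   ideal that contains a non-compact operator.

   (2) Truncating such a factorization approximates compact operators by
   finite-rank ones, so every non-zero closed ideal contains the compact ones.

   (3) By (i) an operator with non-separable range has the form a id + S with
   a <> 0 and S of separable range.  If its range lay in a weakly compactly
   generated subspace, then countably many functions would separate the points of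
   K as well as all of C(K) does.  But for f in C(K), f(p_a) = f(oo) for all
   but countably many a in A, where p_a is the limit point of a and oo the
   ultrafilter of the sets almost containing co-countably many members of A. *)

Set Implicit Arguments.
Unset Strict Implicit.
Unset Printing Implicit Defensive.

Import Order.TTheory GRing.Theory Num.Theory.
Import numFieldNormedType.Exports.

Local Open Scope classical_set_scope.
Local Open Scope ring_scope.

(** * Real and complex scalars *)

(** Together with [compact_discs], this is all that is specific to the real and complex fields;
    later arguments run over an abstract [F] with these two properties. *)
Definition archimedean_norm (F : numFieldType) :=
  forall x : F, exists n : nat, `|x| < n%:R.

Definition compact_discs (F : numFieldType) :=
  forall r : F, compact [set x : F^o | `|x| <= r].

Lemma ultra_fmap (T U : Type) (G : set_system T) (f : T -> U) :
  UltraFilter G -> UltraFilter (f @ G).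
Proof.
move=> GU; split=> [|H HF GH]; first exact: fmap_proper_filter.
apply/seteqP; split=> // A HA.
have [//|GA] := in_ultra_setVsetC (f @^-1` A) GU.
have HcA : H (~` A) by apply: GH.
by have [y []] := filter_ex (filterI HA HcA).
Qed.

Lemma archimedean_realType (R : realType) : archimedean_norm R.
Proof. by move=> x; exists (Num.bound `|x|); exact: archi_boundP. Qed.

Lemma compact_discs_realType (R : realType) : compact_discs R.
Proof.
move=> r; have -> : [set x : R^o | `|x| <= r] = [set` `[- r, r]%R].
  by apply/seteqP; split=> x /=; rewrite in_itv /= ler_norml.
exact: segment_compact.
Qed.

Lemma archimedean_complex (R : realType) : archimedean_norm R[i].
Proof.
case=> a b; have [n] := archimedean_realType (Num.sqrt (a ^+ 2 + b ^+ 2)).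
rewrite ger0_norm ?sqrtr_ge0// => ltn; exists n.
by rewrite normc_def /= -(rmorph_nat (real_complex R)) ltcR.
Qed.

Lemma sqrt_sumsq_le (R : realType) (u v : R) :
  Num.sqrt (u ^+ 2 + v ^+ 2) <= `|u| + `|v|.
Proof.
rewrite -[leRHS]ger0_norm ?addr_ge0// -sqrtr_sqr ler_wsqrtr//.
rewrite sqrrD !real_normK ?num_real// addrAC lerDl.
by rewrite mulrn_wge0 ?mulr_ge0.
Qed.

(** Real and imaginary parts are bounded by the norm, so along an ultrafilter on the disc both
    converge, by compactness in the real case. *)
Lemma compact_discs_complex (R : realType) : compact_discs R[i].
Proof.
move=> r; rewrite compact_ultra => G GU Gr.
have lim (h : R[i] -> R^o) : (forall z, `|h z| <= complex.Re `|z|) ->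
    exists l : R, h @ G --> (l : R^o).
  move=> hle; have hU := ultra_fmap h GU.
  have := @compact_discs_realType R (complex.Re r).
  rewrite compact_ultra => /(_ (h @ G) hU)[|l [_ hl]]; last by exists l.
  apply: (@filterS _ G _ _ (h @^-1` [set x | `|x| <= complex.Re r]) _ Gr).
  move=> z /= zr; apply: le_trans (hle z) _.
  by move: zr; rewrite lecE => /andP[].
have [a ca] : exists l : R, (fun z => complex.Re z) @ G --> (l : R^o).
  apply: lim => -[x y]; rewrite normc_def /=.
  by rewrite -sqrtr_sqr ler_wsqrtr// lerDl sqr_ge0.
have [b cb] : exists l : R, (fun z => complex.Im z) @ G --> (l : R^o).
  apply: lim => -[x y]; rewrite normc_def /=.
  by rewrite -sqrtr_sqr ler_wsqrtr// lerDr sqr_ge0.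
have cG : (id : R[i]^o -> R[i]^o) @ G --> ((a +i* b)%C : R[i]^o).
  apply/cvgrPdist_lt => -[e e']; rewrite ltcE /= => /andP[/eqP -> e0].
  move/cvgrPdist_lt : ca => /(_ (e / 2)); rewrite divr_gt0 ?ltr0n// => /(_ isT) ca.
  move/cvgrPdist_lt : cb => /(_ (e / 2)); rewrite divr_gt0 ?ltr0n// => /(_ isT) cb.
  apply: filterS2 ca cb => -[x y] /= ax by_; rewrite normc_def /= ltcR.
  rewrite [ltRHS]splitr; apply: le_lt_trans (ltrD ax by_).
  exact: sqrt_sumsq_le.
exists ((a +i* b)%C); split=> //.
have [z0 z0r] := filter_ex Gr.
have rr : r \is Num.real by rewrite ger0_real// (le_trans _ z0r).
rewrite /= real_leNgt ?normr_real//; apply/negP => rl.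
have e0 : 0 < `|(a +i* b)%C| - r by rewrite subr_gt0.
move/cvgrPdist_lt : cG => /(_ _ e0) cG.
have [z [/= zr]] := filter_ex (filterI Gr cG).
rewrite ltrBrDr => h; have := ler_normD ((a +i* b)%C - z) z.
rewrite subrK => /le_lt_trans/(_ (le_lt_trans (lerD (lexx _) zr) h)).
by rewrite ltxx.
Qed.

(** * Bounded operators, separability and total boundedness *)

Section ArchimedeanScalars.
Variable F : numFieldType.
Hypothesis arch : archimedean_norm F.

Lemma archi_inv_lt (e : F) : 0 < e -> exists n : nat, n.+1%:R^-1 < e.
Proof.
move=> e0; have [n] := arch e^-1; rewrite gtr0_norm ?invr_gt0// => en.
exists n; rewrite -[ltRHS]invrK ltf_pV2 ?posrE ?invr_gt0 ?ltr0n//.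
by rewrite (lt_trans en)// ltr_nat.
Qed.

End ArchimedeanScalars.

Section BoundedOperators.
Variable F : numFieldType.
Implicit Types X Y Z : normedModType F.

Lemma linear_bundle X Y (T : X -> Y) : linear T ->
  exists f : {linear X -> Y}, T = f.
Proof.
move=> lT; pose m := GRing.isLinear.Build F X Y _ T lT.
by exists (HB.pack T m : {linear X -> Y}).
Qed.

Lemma bounded_opsP X Y (T : X -> Y) : bounded_ops X Y T <->
  exists f : {linear X -> Y}, T = f /\
  exists2 C : F, 0 < C & forall x, `|f x| <= C * `|x|.
Proof.
split=> [[/linear_bundle[f ->] cf]|[f [-> [C C0 fC]]]].
  exists f; split=> //; move: cf => /(_ 0) /cvgrPdist_lt /(_ 1 ltr01).
  rewrite linear0 => /nbhs_ballP[d /= d0 fd].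
  (* Vectors rescaled to norm [d / 2] lie in the ball on which [f] has norm below 1. *)
  exists (2 / d) => [|x]; first by rewrite divr_gt0.
  have [->|x0] := eqVneq x 0; first by rewrite linear0 !normr0 mulr0.
  have nx : 0 < `|x| by rewrite normr_gt0.
  have c0 : 0 < d / 2 / `|x| by rewrite !divr_gt0.
  have : ball 0 d (d / 2 / `|x| *: x).
    rewrite -ball_normE /ball_ /= sub0r normrN normrZ gtr0_norm//.
    by rewrite divfK ?gt_eqF// gtr_pMr// invf_lt1 ?ltr1n.
  move=> /fd /=; rewrite sub0r normrN linearZ normrZ gtr0_norm// => /ltW h.
  rewrite -(ler_pM2l c0) (le_trans h)// mulrACA.
  by rewrite [X in _ <= X](_ : _ = 1)//; field; rewrite !gt_eqF.
split=> [|x]; first by move=> a u v; rewrite linearP.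
apply/cvgrPdist_lt => e e0; apply/nbhs_ballP; exists (e / C) => /=.
  exact: divr_gt0.
move=> y; rewrite -ball_normE /ball_ /= => xy; rewrite -linearB.
by rewrite (le_lt_trans (fC _))// mulrC -ltr_pdivlMr.
Qed.

Lemma bounded_ops_bound X Y (T : X -> Y) : bounded_ops X Y T ->
  exists2 C : F, 0 < C & forall x, `|T x| <= C * `|x|.
Proof. by move=> /bounded_opsP[f [-> []]] C C0 h; exists C. Qed.

Lemma bounded_ops_linear X Y (T : X -> Y) : bounded_ops X Y T ->
  exists f : {linear X -> Y}, T = f.
Proof. by case=> /linear_bundle. Qed.

Lemma bounded_opsI X Y (T : X -> Y) (C : F) : linear T -> 0 <= C ->
  (forall x, `|T x| <= C * `|x|) -> bounded_ops X Y T.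
Proof.
move=> /linear_bundle[f ->] C0 fC; apply/bounded_opsP; exists f; split => //.
exists (C + 1) => [|x]; first by rewrite ltr_wpDl.
by rewrite (le_trans (fC x))// ler_wpM2r// lerDl.
Qed.

Lemma bounded_ops_comp X Y Z (S : Y -> Z) (T : X -> Y) :
  bounded_ops Y Z S -> bounded_ops X Y T -> bounded_ops X Z (S \o T).
Proof.
move=> [lS cS] [lT cT]; split=> [a u v /=|x]; first by rewrite lT lS.
by apply: continuous_comp; [exact: cT|exact: cS].
Qed.

Lemma bounded_ops_id X : bounded_ops X X id.
Proof. by split=> // x; exact: cvg_id. Qed.

Lemma bounded_ops0 X Y : bounded_ops X Y (0 : X -> Y).
Proof.
split=> [a u v|x]; last exact: cvg_cst.
by rewrite [RHS]addr0 [RHS]scaler0.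
Qed.

Lemma bounded_opsD X Y (S T : X -> Y) :
  bounded_ops X Y S -> bounded_ops X Y T -> bounded_ops X Y (S + T).
Proof.
move=> [lS cS] [lT cT]; split=> [a u v|x]; last by apply: cvgD; [exact: cS|exact: cT].
by rewrite /= !fctE lS lT scalerDr addrACA.
Qed.

Lemma bounded_opsZ X Y (a : F) (T : X -> Y) :
  bounded_ops X Y T -> bounded_ops X Y (a *: T).
Proof.
move=> [lT cT]; split=> [b u v|x]; last by apply: cvgZl_tmp; exact: cT.
by rewrite /= !fctE lT scalerDr !scalerA mulrC.
Qed.

End BoundedOperators.

Section Density.
Variables (F : numFieldType) (V : normedModType F).
Hypothesis arch : archimedean_norm F.
Implicit Types A B : set V.

(** The approximating sequence may leave [A], which lets the notion pass to subsets. *)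
Definition seq_dense (W : normedModType F) (A : set W) :=
  exists d : nat -> W, forall x, A x -> forall e : F, 0 < e ->
    exists n, `|x - d n| < e.

Lemma closureP A (x : V) :
  closure A x <-> forall e : F, 0 < e -> exists2 y, A y & `|x - y| < e.
Proof.
split=> [Ax e e0|h B /nbhs_ballP[e /= e0 eB]].
  have [|y [Ay]] := Ax (ball x e); first exact: nbhsx_ballx.
  by rewrite -ball_normE; exists y.
have [y Ay xy] := h _ e0; exists y; split=> //; apply: eB.
by rewrite -ball_normE.
Qed.

(** For each pair [(n, m)] a point of [A] within [m.+1%:R^-1] of [d n] is selected if there is one,
    with default [x0]. *)
Lemma seq_dense_inner A (x0 : V) : A x0 -> seq_dense A ->
  exists d : nat -> V, (forall n, A (d n)) /\
    forall x, A x -> forall e : F, 0 < e -> exists n, `|x - d n| < e.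
Proof.
move=> Ax0 [d dA].
pose g (p : nat * nat) := xget x0 [set y | A y /\ `|y - d p.1| < p.2.+1%:R^-1].
exists (fun n => if unpickle n is Some p then g p else x0); split=> [n|x Ax e e0].
  case: unpickle => // p.
  by rewrite /g; case: xgetP => [z _ []//|].
have [|m me] := archi_inv_lt arch (e := e / 2); first exact: divr_gt0.
have [|n xn] := dA _ Ax m.+1%:R^-1; first by rewrite invr_gt0.
exists (pickle (n, m)); rewrite pickleK.
rewrite /g; case: xgetP => [z _ [Az /= zn]|/(_ x)[]//].
rewrite (le_lt_trans (ler_distD (d n) _ _))// [ltRHS]splitr (distrC (d n)).
by rewrite ltrD ?(lt_trans xn)// (lt_trans zn).
Qed.

Lemma separableP A : separable A <-> seq_dense A.
Proof.
split=> [[D [/countable_injP[f finj] _ AD]]|dA].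
  exists (fun n => xget 0 [set x | D x /\ f x = n]) => x Ax e e0.
  have [y Dy xy] := (closureP _ _).1 (AD _ Ax) _ e0.
  exists (f y); case: xgetP => [z _ [Dz fz]|/(_ y)[]//].
  by rewrite (finj _ _ _ _ fz)// inE.
have [[x0 Ax0]|A0] := pselect (exists x, A x); last first.
  by exists set0; split=> // x Ax; case: A0; exists x.
have [d [Ad dP]] := seq_dense_inner Ax0 dA.
exists (range d); split; first exact: sub_countable (card_image_le _ _) _.
  by move=> _ [n _ <-].
move=> x Ax; apply/closureP => e e0.
by have [n xn] := dP _ Ax _ e0; exists (d n) => //; exists n.
Qed.

Lemma seq_dense_sub A B : A `<=` B -> seq_dense B -> seq_dense A.
Proof. by move=> AB [d dB]; exists d => x /AB; exact: dB. Qed.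

Lemma seq_dense_closure A : seq_dense A -> seq_dense (closure A).
Proof.
move=> [d dA]; exists d => x /closureP Ax e e0.
have e2 : 0 < e / 2 by exact: divr_gt0.
have [y Ay xy] := Ax _ e2; have [n yn] := dA _ Ay _ e2.
by exists n; rewrite (le_lt_trans (ler_distD y _ _))// [ltRHS]splitr ltrD.
Qed.

Lemma seq_dense_bigcup (A : nat -> set V) :
  (forall n, seq_dense (A n)) -> seq_dense (\bigcup_n A n).
Proof.
move=> /choice[d dA].
pose g n := if @unpickle (nat * nat)%type n is Some p then d p.1 p.2 else 0.
exists g => x [i _ Aix] e e0; have [n xn] := dA _ _ Aix _ e0.
by exists (pickle (i, n)); rewrite /g pickleK.
Qed.

Lemma seq_denseD A B : seq_dense A -> seq_dense B ->
  seq_dense [set x + y | x in A & y in B].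
Proof.
move=> [d dA] [d' dB].
pose g n := if @unpickle (nat * nat)%type n is Some p then d p.1 + d' p.2 else 0.
exists g => _ [x Ax [y By <-]] e e0.
have e2 : 0 < e / 2 by exact: divr_gt0.
have [n xn] := dA _ Ax _ e2; have [m ym] := dB _ By _ e2.
exists (pickle (n, m)); rewrite /g pickleK /= opprD addrACA.
by rewrite (le_lt_trans (ler_normD _ _))// [ltRHS]splitr ltrD.
Qed.

Definition totally_bounded (W : normedModType F) (A : set W) :=
  forall e : F, 0 < e -> exists s : seq W,
    forall x, A x -> exists2 y, y \in s & `|x - y| < e.

Lemma totally_bounded_sub A B : A `<=` B -> totally_bounded B ->
  totally_bounded A.
Proof. by move=> AB tB e /tB[s sB]; exists s => x /AB; exact: sB. Qed.

Lemma totally_bounded_inner A e : totally_bounded A -> 0 < e ->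
  exists s : seq V, (forall y, y \in s -> A y) /\
    forall x, A x -> exists2 y, y \in s & `|x - y| < e.
Proof.
move=> tA e0; have [|s sA] := tA (e / 2); first exact: divr_gt0.
have [[x0 Ax0]|A0] := pselect (exists x, A x); last first.
  by exists [::]; split=> // x Ax; case: A0; exists x.
pose g y := xget x0 [set x | A x /\ `|x - y| < e / 2].
exists (map g s); split=> [_ /mapP[y _ ->]|x Ax].
  by rewrite /g; case: xgetP => [z _ []//|].
have [y ys xy] := sA _ Ax; exists (g y); first exact: map_f.
rewrite /g; case: xgetP => [z _ [Az zy]|/(_ x)[]//].
rewrite (le_lt_trans (ler_distD y _ _))// [ltRHS]splitr (distrC y).
by rewrite ltrD.
Qed.

(** Pigeonhole: given a finite net of radius [e / 2], more terms than net points force two terms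
    within [e] of each other. *)
Lemma totally_bounded_separated A (x : nat -> V) (e : F) : 0 < e ->
  totally_bounded A -> (forall n, A (x n)) ->
  (forall m n, (m < n)%N -> ~ `|x n - x m| < e) -> False.
Proof.
move=> e0 tA Ax sep.
have [|s sA] := tA (e / 2); first exact: divr_gt0.
have /choice[i ip] : forall n, exists i : 'I_(size s), `|x n - s`_i| < e / 2.
  move=> n; have [y ys xy] := sA _ (Ax n).
  by rewrite -index_mem in ys; exists (Ordinal ys); rewrite /= nth_index -?index_mem.
pose h := fun k : 'I_(size s).+1 => i (nat_of_ord k).
have : ~ injective h by move=> /leq_card; rewrite !card_ord ltnn.
apply => k l hkl; apply/eqP/negP => /negP kl.
have close m n : i m = i n -> `|x m - x n| < e.
  move=> mn; rewrite (le_lt_trans (ler_distD (s`_(i m)) _ _))// [ltRHS]splitr.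
  by rewrite ltrD ?ip// distrC mn ip.
move: kl; rewrite -val_eqE /= neq_ltn => /orP[kl|kl].
  by apply: (sep _ _ kl); exact: close.
by apply: (sep _ _ kl); exact: close.
Qed.

Lemma compact_totally_bounded A : compact A -> totally_bounded A.
Proof.
rewrite compact_cover => cA e e0.
have [||D DA Acov] := cA V A (fun y => ball y e).
- by move=> y _; exact: ball_open.
- by move=> x Ax; exists x => //; exact: ballxx.
exists (enum_fset D) => x /Acov[y /= yD]; rewrite -ball_normE /= distrC => xy.
by exists y.
Qed.

Lemma totally_bounded_seq_dense A : totally_bounded A -> seq_dense A.
Proof.
move=> tA.
have /choice[s sA] : forall n, exists s : seq V, forall x, A x ->
    exists2 y, y \in s & `|x - y| < n.+1%:R^-1.
  by move=> n; apply: tA; rewrite invr_gt0.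
pose g n := if @unpickle (nat * nat)%type n is Some p then (s p.1)`_(p.2) else 0.
exists g => x Ax e e0; have [n ne] := archi_inv_lt arch e0.
have [y ys xy] := sA n _ Ax; exists (pickle (n, index y (s n))).
by rewrite /g pickleK /= nth_index// (lt_trans xy).
Qed.

End Density.

(** * Spaces of continuous functions *)

Section ContinuousFunctionSpace.
Variables (F : numFieldType) (K : compactSpaceType).
Local Notation X := (CK K F).

Lemma CK_norm_ge (f : X) (t : K) : `|val f t| <= `|f|.
Proof. exact: le_sup_norm (CK_attains_max f). Qed.

Lemma CK_norm_attained (f : X) : f != 0 -> exists t, `|f| = `|val f t|.
Proof.
move=> f0; have [[t ht]|T0] := CK_attains_max f.
  by exists t; exact: sup_norm_max ht.
by case/eqP: f0; apply: val_inj; apply/funext => t; case: (T0 t).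
Qed.

Lemma CK_norm_le (f : X) (c : F) : 0 <= c -> (forall t, `|val f t| <= c) ->
  `|f| <= c.
Proof.
move=> c0 fc; have [->|/CK_norm_attained[t ->]] := eqVneq f 0; last exact: fc.
by rewrite normr0.
Qed.

Lemma CK_cont (f : X) : continuous (val f).
Proof. exact/asboolP/(valP f). Qed.

Lemma CKI (g : K -> F^o) : continuous g -> exists f : X, val f = g.
Proof. by move=> /asboolT cg; exists (exist _ g cg). Qed.

Definition evaluation (t : K) : X -> F^o := fun f => val f t.

Lemma bounded_evaluation (t : K) : bounded_ops X F^o (evaluation t).
Proof.
apply: (@bounded_opsI _ _ _ _ 1) => // x; rewrite mul1r; exact: CK_norm_ge.
Qed.

Hypothesis discs : compact_discs F.

(* An ultrafilter concentrating on a totally bounded set of functions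
   converges pointwise because discs are compact; total boundedness makes the
   convergence uniform, so the limit is continuous. *)
Lemma totally_bounded_precompact (A : set X) :
  totally_bounded A -> precompact A.
Proof.
move=> tA; rewrite precompactE compact_ultra => G GU GA.
have near_ball (e : F) : 0 < e -> exists y, G [set x | `|x - y| < e].
  move=> e0; have [|s sA] := tA (e / 2); first exact: divr_gt0.
  have : G [set x | exists2 y, y \in s & `|x - y| < e].
    apply: filterS GA => x /closureP Ax.
    have [|z Az xz] := Ax (e / 2); first exact: divr_gt0.
    have [y ys zy] := sA _ Az; exists y => //.
    by rewrite (le_lt_trans (ler_distD z _ _))// [ltRHS]splitr ltrD.
  (* The ultrafilter contains a finite union of balls, hence one of them. *)
  elim: s {sA} => [h|z s IH h].
    by have [x [y]] := filter_ex h; rewrite in_nil.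
  have [hz|hz] := in_ultra_setVsetC [set x | `|x - z| < e] GU; first by exists z.
  apply: IH; apply: filterS (filterI h hz) => x [[y]].
  by rewrite inE => /predU1P[->//|ys xy _]; exists y.
have /choice[f fcvg] : forall t, exists l : F^o, evaluation t @ G --> l.
  move=> t; have [y Gy] := near_ball 1 ltr01.
  have hU := ultra_fmap (evaluation t) GU.
  have := @discs (1 + `|y|); rewrite compact_ultra.
  move=> /(_ (evaluation t @ G) hU)[|l [_ hl]]; last by exists l.
  apply: (@filterS _ G _ _ _ _ Gy) => x /= /ltW xy.
  rewrite -(subrK (val y t) (evaluation t x)) (le_trans (ler_normD _ _))//.
  by rewrite lerD ?CK_norm_ge// (le_trans _ xy)// -[leLHS]/(`|val (x - y) t|) CK_norm_ge.
have near_f (e : F) y t : 0 < e -> G [set x | `|x - y| < e] -> `|f t - val y t| < e *+ 2.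
  move=> e0 Gy; move/cvgrPdist_lt : (fcvg t) => /(_ _ e0) ft.
  have [x [/= xy fx]] := filter_ex (filterI Gy ft).
  rewrite mulr2n (le_lt_trans (ler_distD (val x t) _ _))// ltrD//.
  by rewrite (le_lt_trans _ xy)// -[leLHS]/(`|val (x - y) t|) CK_norm_ge.
have cf : continuous (f : K -> F^o).
  move=> t; apply/cvgrPdist_lt => e e0.
  have e6 : 0 < e / 5%:R by rewrite divr_gt0 ?ltr0n.
  have [y Gy] := near_ball _ e6.
  have /cvgrPdist_lt /(_ _ e6) := @CK_cont y t.
  apply: filterS => s ys.
  rewrite (le_lt_trans (ler_distD (val y t) _ _))//.
  rewrite (le_lt_trans (lerD (lexx _) (ler_distD (val y s) _ _)))//.
  have -> : e = (e / 5%:R) *+ 2 + (e / 5%:R + (e / 5%:R) *+ 2) by field.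
  apply: ltrD; first exact: near_f.
  by apply: ltrD => //; rewrite distrC; exact: near_f.
have [g gf] := CKI cf; exists g.
have cg : (id : X -> X) @ G --> g.
  apply/cvgrPdist_lt => e e0.
  have e6 : 0 < e / 4%:R by rewrite divr_gt0 ?ltr0n.
  have [y Gy] := near_ball _ e6.
  move: (Gy); apply: filterS => x /= xy; rewrite (le_lt_trans (ler_distD y _ _))//.
  rewrite (distrC y).
  have -> : e = (e / 4%:R) *+ 3 + (e / 4%:R) by field.
  apply: ltrD xy.
  rewrite (@le_lt_trans _ _ ((e / 4%:R) *+ 2))// ?ltr_pMn2l//.
  apply: CK_norm_le; first by rewrite mulrn_wge0// ltW.
  by move=> t; have /ltW := near_f _ _ t e6 Gy; rewrite -gf.
split=> //; apply/closureP => e e0.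
have e2 : 0 < e / 2 by exact: divr_gt0.
move/cvgrPdist_lt : cg => /(_ _ e2) cg.
have [x [/closureP Ax /= gx]] := filter_ex (filterI GA cg).
have [y Ay xy] := Ax _ e2; exists y => //.
by rewrite (le_lt_trans (ler_distD x _ _))// [ltRHS]splitr ltrD.
Qed.

Lemma precompactP (A : set X) : precompact A <-> totally_bounded A.
Proof.
split; last exact: totally_bounded_precompact.
rewrite precompactE => /compact_totally_bounded; apply: totally_bounded_sub.
exact: subset_closure.
Qed.

End ContinuousFunctionSpace.

(** * The space of null sequences *)

Section NullSequenceSpace.
Variable F : numFieldType.
Local Notation c0 := (c0 F).

Lemma c0_ext (u v : c0) : (forall i, val u i = val v i) -> u = v.
Proof. by move=> uv; apply: val_inj; apply/funext. Qed.

Lemma c0_norm_ge (u : c0) i : `|val u i| <= `|u|.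
Proof. exact: le_sup_norm (c0_attains_max u). Qed.

Lemma c0_norm_le (u : c0) (c : F) : (forall i, `|val u i| <= c) -> `|u| <= c.
Proof.
move=> uc; have [[i ui]|T0] := c0_attains_max u; last by case: (T0 0%N).
have -> : `|u| = `|val u i| by exact: sup_norm_max ui.
exact: uc.
Qed.

Lemma c0_norm_attained (u : c0) : exists i, `|u| = `|val u i|.
Proof.
have [[i ui]|T0] := c0_attains_max u; last by case: (T0 0%N).
by exists i; exact: sup_norm_max ui.
Qed.

Definition null_seq (u : nat -> F) :=
  forall e : F, 0 < e -> exists N, forall n, (N <= n)%N -> `|u n| < e.

Lemma null_seqP (u : nat -> F) : null_pred u <-> null_seq u.
Proof.
split=> [/asboolP/cvgrPdist_lt cu e /cu[N _ uN]|uN].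
  by exists N => n Nn; have := uN _ Nn; rewrite sub0r normrN.
apply/asboolP/cvgrPdist_lt => e /uN[N Nu].
by exists N => // n /= /Nu; rewrite sub0r normrN.
Qed.

Lemma c0_null (u : c0) : null_seq (val u).
Proof. exact/null_seqP/(valP u). Qed.

(** A sequence that is not null is sent to 0, so its coordinates are computed only from a proof of
    [null_seq]. *)
Definition mkc0 (u : nat -> F) : c0 := insubd (0 : c0) (u : nat -> F^o).

Lemma mkc0E (u : nat -> F) : null_seq u -> val (mkc0 u) = u.
Proof. by move=> nu; rewrite insubdK//; apply/null_seqP. Qed.

Lemma null_seq_finite (u : nat -> F) N :
  (forall n, (N <= n)%N -> u n = 0) -> null_seq u.
Proof. by move=> u0 e e0; exists N => n /u0 ->; rewrite normr0. Qed.

Lemma null_seq_dominated (u v : nat -> F) :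
  (forall n, `|u n| <= `|v n|) -> null_seq v -> null_seq u.
Proof.
by move=> uv nv e /nv[N vN]; exists N => n /vN; exact: le_lt_trans (uv n).
Qed.

Definition trunc n (u : c0) := mkc0 (fun i => if (i < n)%N then val u i else 0).

Lemma truncE n (u : c0) i : val (trunc n u) i = if (i < n)%N then val u i else 0.
Proof. by rewrite mkc0E//; apply: (@null_seq_finite _ n) => k; rewrite ltnNge => ->. Qed.

Lemma trunc_norm n (u : c0) : `|trunc n u| <= `|u|.
Proof.
apply: c0_norm_le => i; rewrite truncE; case: ifP => _; first exact: c0_norm_ge.
by rewrite normr0.
Qed.

Lemma trunc_tail_norm n (u : c0) : `|u - trunc n u| <= `|u|.
Proof.
apply: c0_norm_le => i.
rewrite -[val _ i]/(val u i - val (trunc n u) i) truncE.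
by case: ifP => _; rewrite ?subrr ?subr0 ?normr0//; exact: c0_norm_ge.
Qed.

Lemma trunc_cvg (u : c0) (e : F) : 0 < e ->
  exists N, forall n, (N <= n)%N -> `|u - trunc n u| < e.
Proof.
move=> e0; have [N uN] := c0_null u e0; exists N => n Nn.
have [i ->] := c0_norm_attained (u - trunc n u).
rewrite -[val _ i]/(val u i - val (trunc n u) i) truncE.
case: ltnP => ni; first by rewrite subrr normr0.
by rewrite subr0 uN// (leq_trans Nn).
Qed.

Definition unit_vec k := mkc0 (fun i => (i == k)%:R).

Lemma unit_vecE k i : val (unit_vec k) i = (i == k)%:R.
Proof.
by rewrite mkc0E//; apply: (@null_seq_finite _ k.+1) => n; case: eqVneq => // ->; rewrite ltnn.
Qed.

Lemma c0_sumE n (G : nat -> c0) i :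
  val (\sum_(k < n) G k) i = \sum_(k < n) val (G k) i.
Proof. by elim/big_rec2: _ => // k x y _ <-. Qed.

Lemma trunc_sum n (u : c0) : trunc n u = \sum_(k < n) val u k *: unit_vec k.
Proof.
apply: c0_ext => i; rewrite (c0_sumE _ (fun k => val u k *: unit_vec k)) truncE.
transitivity (\sum_(k < n) (if i == k then val u i else 0)).
  rewrite -big_mkcond /=; case: ltnP => ni.
    by rewrite (big_pred1 (Ordinal ni)).
  by rewrite big_pred0// => k; apply: contraTF ni => /eqP ->; rewrite -ltnNge.
apply: eq_bigr => k _; rewrite -[RHS]/(val u k * val (unit_vec k) i) unit_vecE.
by case: eqVneq => [->|]; rewrite ?mulr1 ?mulr0.
Qed.

Lemma bounded_coordinate i : bounded_ops c0 F^o (fun u => val u i).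
Proof. by apply: (@bounded_opsI _ _ _ _ 1) => // x; rewrite mul1r; exact: c0_norm_ge. Qed.

Lemma coordinatewise_bounded (V : normedModType F) (T : V -> c0) (C : F) :
  0 <= C -> (forall i, linear (fun x => val (T x) i : F^o)) ->
  (forall x i, `|val (T x) i| <= C * `|x|) -> bounded_ops V c0 T.
Proof.
move=> C0 Tl TC; apply: (@bounded_opsI _ _ _ _ C) => // [a x y|x].
  by apply: c0_ext => i; exact: Tl.
exact: c0_norm_le (TC x).
Qed.

Lemma unit_vec_norm_dist (k l : nat) : k <> l -> 1 <= `|unit_vec k - unit_vec l|.
Proof.
move=> kl; apply: le_trans (c0_norm_ge _ k).
rewrite -[val _ k]/(val (unit_vec k) k - val (unit_vec l) k) !unit_vecE eqxx.
by move/eqP/negPf: kl => ->; rewrite subr0 normr1.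
Qed.

Lemma unit_vec_norm_le k : `|unit_vec k| <= 1.
Proof.
by apply: c0_norm_le => i; rewrite unit_vecE; case: eqP => _; rewrite ?normr1 ?normr0.
Qed.

Lemma bounded_trunc n : bounded_ops c0 c0 (trunc n).
Proof.
apply: (@coordinatewise_bounded _ _ 1) => // [i a u v|u i].
  by rewrite /= !truncE; case: ifP => _ //; rewrite scaler0 addr0.
by rewrite mul1r (le_trans (c0_norm_ge _ i))// trunc_norm.
Qed.

End NullSequenceSpace.

(** * Countable dense families of scalars, null sequences and linear combinations *)

Section ScalarDensity.
Variable F : numFieldType.
Hypothesis arch : archimedean_norm F.
Hypothesis discs : compact_discs F.

(** The scalars are a countable union of compact discs, each of them totally bounded. *)
Lemma scalars_seq_dense : exists q : nat -> F,
  forall a (e : F), 0 < e -> exists n, `|a - q n| < e.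
Proof.
have [|q qd] := @seq_dense_bigcup F F^o (fun n => [set x : F^o | `|x| <= n%:R]).
  move=> n; apply: totally_bounded_seq_dense => //.
  by apply: compact_totally_bounded; exact: discs.
exists q => a e e0; apply: qd e0; have [n an] := arch a.
by exists n => //=; exact: ltW.
Qed.

(** Finite lists of indices into [q] replace tuples of scalars; being countable, they enumerate
    dense families through [pickle]. *)
Lemma seq_approx (q : nat -> F) :
  (forall a (e : F), 0 < e -> exists n, `|a - q n| < e) ->
  forall (a : nat -> F) n (e : F), 0 < e ->
  exists s : seq nat, size s = n /\
    forall i, (i < n)%N -> `|a i - q (nth 0%N s i)| < e.
Proof.
move=> qd a n e e0; have /choice[h hP] := fun i => qd (a i) _ e0.
by exists (mkseq h n); rewrite size_mkseq; split=> // i ni; rewrite nth_mkseq.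
Qed.

Lemma c0_seq_dense : seq_dense [set: c0 F].
Proof.
have [q qd] := scalars_seq_dense.
pose g (n : nat) := if unpickle n is Some s then
  mkc0 (fun i => if (i < size s)%N then q (nth 0%N s i) else 0) else 0.
exists g => u _ e e0.
have [N uN] := c0_null u e0; have [s [sN sa]] := seq_approx qd (val u) N e0.
exists (pickle s); rewrite /g pickleK; set v := mkc0 _.
have [i ->] := c0_norm_attained (u - v).
rewrite -[val _ i]/(val u i - val v i) mkc0E; last first.
  by apply: (@null_seq_finite _ _ (size s)) => k; rewrite ltnNge => ->.
by rewrite sN; case: ltnP => iN; rewrite ?subr0; [exact: sa|exact: uN].
Qed.

Lemma span_seq_dense (V : normedModType F) (f : nat -> V) :
  (forall n, `|f n| <= 1) ->
  seq_dense [set x | exists n (a : nat -> F), x = \sum_(i < n) a i *: f i].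
Proof.
move=> f1; have [q qd] := scalars_seq_dense.
pose g (n : nat) := if @unpickle (seq nat) n is Some s then
  \sum_(i < size s) q (nth 0%N s i) *: f i else 0.
exists g => _ [n [a ->]] e e0.
(* The successor covers [n = 0] and makes the sum of [n] errors strictly smaller than [e]. *)
have en : 0 < e / n.+1%:R by rewrite divr_gt0 ?ltr0n.
have [s [sn sa]] := seq_approx qd a n en.
exists (pickle s); rewrite /g pickleK sn -sumrB.
apply: (@le_lt_trans _ _ (\sum_(i < n) e / n.+1%:R)).
  apply: le_trans (ler_norm_sum _ _ _) _; apply: ler_sum => i _.
  rewrite -scalerBl normrZ -[leRHS]mulr1 ler_pM//.
  by rewrite ltW// sa.
rewrite sumr_const card_ord -[ltLHS]mulr_natr -mulrA gtr_pMr//.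
by rewrite mulrC ltr_pdivrMr ?ltr0n// mul1r ltr_nat.
Qed.

End ScalarDensity.

(** * Tails and block operators on null sequences *)

Section Tails.
Variable F : numFieldType.
Hypothesis arch : archimedean_norm F.
Local Notation c0 := (c0 F).

Lemma incr_homo (s : nat -> nat) : (forall j, (s j < s j.+1)%N) ->
  forall i j, (i <= j)%N -> (s i <= s j)%N.
Proof.
move=> s_incr i j /subnK <-; elim: (j - i)%N => // k IH.
by rewrite (leq_trans IH)// ltnW// addSn.
Qed.

Lemma incr_ge (s : nat -> nat) : (forall j, (s j < s j.+1)%N) ->
  forall j, (j <= s j)%N.
Proof. by move=> s_incr; elim=> // j IH; rewrite (leq_ltn_trans IH). Qed.

Lemma disjoint_normD (u v : c0) (c : F) m : `|u| <= c -> `|v| <= c ->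
  (forall i, (m <= i)%N -> val u i = 0) ->
  (forall i, (i < m)%N -> val v i = 0) -> `|u + v| <= c.
Proof.
move=> uc vc u0 v0; apply: c0_norm_le => i.
rewrite -[val _ i]/(val u i + val v i); have [im|mi] := ltnP i m.
  by rewrite v0// addr0 (le_trans (c0_norm_ge _ _)).
by rewrite u0// add0r (le_trans (c0_norm_ge _ _)).
Qed.

(* Otherwise infinitely many disjointly supported vectors of norm at most 1
   have image at least eta; the sum of k of them still has norm at most 1, but
   its image is at least k * eta. *)
Lemma functional_tail (phi : c0 -> F^o) (eta : F) :
  bounded_ops c0 F^o phi -> 0 < eta ->
  exists N, forall u, (forall i, (i < N)%N -> val u i = 0) ->
    `|phi u| <= eta * `|u|.
Proof.
move=> /bounded_opsP[f [-> [C C0 fC]]] eta0; apply: contrapT => nN.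
have step N : exists (v : c0) m, [/\ forall i, (i < N)%N -> val v i = 0,
    forall i, (m <= i)%N -> val v i = 0, `|v| <= 1 & eta <= f v].
  have [u [uN fu]] : exists u, (forall i, (i < N)%N -> val u i = 0) /\
      ~ `|f u| <= eta * `|u|.
    apply: contrapT => h; apply: nN; exists N => u uN; apply: contrapT => fu.
    by apply: h; exists u.
  have {}fu : eta * `|u| < `|f u|.
    rewrite real_ltNge ?realM ?normr_real ?gtr0_real//; exact/negP.
  have u0 : 0 < `|u|.
    by rewrite normr_gt0; apply: contraTneq fu => ->; rewrite linear0 !normr0 mulr0 ltxx.
  (* The margin in the strict inequality allows [u] to be truncated to finite support without losing
     it. *)
  have g0 : 0 < (`|f u| - eta * `|u|) / C by rewrite divr_gt0// subr_gt0.
  have [m /(_ m (leqnn m)) um] := trunc_cvg u g0.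
  have {um} fm : eta * `|u| < `|f (trunc m u)|.
    have : `|f (u - trunc m u)| < `|f u| - eta * `|u|.
      by rewrite (le_lt_trans (fC _))// mulrC -ltr_pdivlMr.
    rewrite ltrBrDr -ltrBrDl linearB => /lt_le_trans; apply.
    by rewrite lerBlDr -{1}(subrK (f (trunc m u)) (f u)) addrC ler_normD.
  have c0 : f (trunc m u) != 0.
    by rewrite -normr_gt0 (le_lt_trans _ fm)// mulr_ge0// ltW.
  (* The phase factor makes the image positive, so that adding such vectors causes no
     cancellation. *)
  exists ((`|f (trunc m u)| / f (trunc m u) / `|u|) *: trunc m u), m; split.
  - move=> i iN; rewrite -[LHS]/(_ * val (trunc m u) i) truncE uN// if_same.
    by rewrite mulr0.
  - by move=> i mi; rewrite -[LHS]/(_ * val (trunc m u) i) truncE ltnNge mi mulr0.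
  - rewrite normrZ !normrM !normfV !normr_id divff ?normr_eq0// mul1r mulrC.
    by rewrite ler_pdivrMr// mul1r trunc_norm.
  - rewrite linearZ /= -[leRHS]/(_ * f (trunc m u)) mulrAC divfK//.
    by rewrite ler_pdivlMr// ltW.
have big k : exists (v : c0) m, [/\ forall i, (m <= i)%N -> val v i = 0,
    `|v| <= 1 & k%:R * eta <= f v].
  elim: k => [|k [u [m [um u1 fu]]]].
    by exists 0, 0%N; split=> //; rewrite ?normr0// linear0 mul0r.
  have [v [n [vm vn v1 fv]]] := step m.
  exists (u + v), (maxn m n); split.
  - move=> i; rewrite geq_max => /andP[mi ni].
    by rewrite -[LHS]/(val u i + val v i) um// vn// addr0.
  - exact: (disjoint_normD u1 v1 um).
  - by rewrite linearD -addn1 natrD mulrDl mul1r lerD.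
have [k] := arch (C / eta); rewrite gtr0_norm ?divr_gt0// ltr_pdivrMr// => Ck.
have [v [m [_ v1 fv]]] := big k.
have : `|f v| <= C by rewrite (le_trans (fC v))// ler_piMr// ltW.
rewrite ger0_norm; last by rewrite (le_trans _ fv)// mulr_ge0 // ltW.
by move=> /(le_trans fv) /(lt_le_trans Ck); rewrite ltxx.
Qed.

Section BlockOperator.
Variables (s : nat -> nat) (v : nat -> c0).
Hypothesis s_incr : forall j, (s j < s j.+1)%N.
Hypothesis v_norm : forall j, `|v j| <= 1.
Hypothesis v_supp : forall j i, val (v j) i != 0 -> (s j <= i < s j.+1)%N.

Let s_mono i j : (i <= j)%N -> (s i <= s j)%N.
Proof. exact: incr_homo. Qed.

Let s_ge j : (j <= s j)%N.
Proof. exact: incr_ge. Qed.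

Let block_ex i : exists j, (i < s j.+1)%N.
Proof. by exists i; rewrite (leq_trans _ (s_ge _)). Qed.

Let block i := ex_minn (block_ex i).

Let block_lt i : (i < s (block i).+1)%N.
Proof. by rewrite /block; case: ex_minnP. Qed.

Let block_le i j : (i < s j.+1)%N -> (block i <= j)%N.
Proof. by rewrite /block; case: ex_minnP => m _; apply. Qed.

(** The operator sending the [j]-th unit vector to [v j]. The supports being disjoint, coordinate
    [i] sees only the block [block i]; coordinates below [s 0] fall into block 0, where [v 0]
    vanishes. *)
Definition block_op (u : c0) : c0 :=
  mkc0 (fun i => val u (block i) * val (v (block i)) i).

Let block_opE u i : val (block_op u) i = val u (block i) * val (v (block i)) i.
Proof.
rewrite mkc0E//; apply: (@null_seq_dominated _ _ (val u \o block)) => [n|e e0].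
  rewrite normrM /= ler_piMr// (le_trans (c0_norm_ge _ _))//.
have [N uN] := c0_null u e0; exists (s N) => n Nn; apply: uN.
rewrite leqNgt; apply/negP => bN.
by have := leq_trans (block_lt n) (s_mono bN); rewrite ltnNge Nn.
Qed.

Lemma block_op_norm u : `|block_op u| <= `|u|.
Proof.
apply: c0_norm_le => i; rewrite block_opE normrM.
rewrite (le_trans _ (c0_norm_ge u (block i)))// ler_piMr//.
by rewrite (le_trans (c0_norm_ge _ _)).
Qed.

Lemma bounded_block_op : bounded_ops c0 c0 block_op.
Proof.
apply: (@coordinatewise_bounded _ _ _ 1) => // [i a x y|x i].
  rewrite /= !block_opE -[val (_ + _) _]/(a * val x (block i) + val y (block i)).
  by rewrite mulrDl -mulrA.
by rewrite mul1r (le_trans (c0_norm_ge _ _))// block_op_norm.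
Qed.

(** Stands in for the expansion of the image as a series in the [v i]: the remainder is a tail, on
    which a bounded functional is small. *)
Lemma block_op_split u j : exists r : c0,
  [/\ block_op u = \sum_(i < j.+1) val u i *: v i + r,
      forall i, (i < s j.+1)%N -> val r i = 0 & `|r| <= `|u|].
Proof.
exists (block_op u - trunc (s j.+1) (block_op u)); split; last 2 first.
- move=> i ij; rewrite -[LHS]/(val (block_op u) i - val (trunc (s j.+1) (block_op u)) i).
  by rewrite truncE ij subrr.
- exact: le_trans (trunc_tail_norm _ _) (block_op_norm _).
suff -> : trunc (s j.+1) (block_op u) = \sum_(i < j.+1) val u i *: v i.
  by rewrite addrC subrK.
apply: c0_ext => i; rewrite (c0_sumE _ (fun k => val u k *: v k)) truncE.
case: ltnP => [ij|ji]; last first.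
  rewrite big1// => k _; rewrite -[LHS]/(val u k * val (v k) i).
  have [->|/v_supp/andP[_ ik]] := eqVneq (val (v k) i) 0; first by rewrite mulr0.
  by have := leq_trans ik (s_mono (ltn_ord k)); rewrite ltnNge ji.
have bj : (block i < j.+1)%N by rewrite ltnS block_le.
rewrite (bigD1 (Ordinal bj)) //= big1 ?addr0 ?block_opE// => k kb.
rewrite -[LHS]/(val u k * val (v k) i).
have [->|/v_supp/andP[ki ik]] := eqVneq (val (v k) i) 0; first by rewrite mulr0.
have bk := block_le ik; have : (block i < k)%N.
  by rewrite ltn_neqAle bk andbT eq_sym; apply: contraNneq kb => e; apply/eqP/val_inj.
by move=> /s_mono; move/(leq_trans (block_lt i)); rewrite ltnNge ki.
Qed.

End BlockOperator.

(** Each step passes the current index and the threshold attached to it; monotonicity carries the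
    relation to all later indices. *)
Lemma eventually_select (R : nat -> nat -> Prop) (k0 : nat) :
  (forall l, exists N, forall k, (N <= k)%N -> R l k) ->
  exists psi : nat -> nat, [/\ (k0 <= psi 0)%N,
    forall i, (psi i < psi i.+1)%N & forall i j, (i < j)%N -> R (psi i) (psi j)].
Proof.
move=> /choice[g gR]; pose h l := maxn l.+1 (g l).
pose psi i := iter i h k0.
have psi_lt i : (psi i < psi i.+1)%N by rewrite /psi /= /h leq_max leqnn.
have psi_mono : {homo psi : i j / (i <= j)%N}.
  by move=> i j; exact: incr_homo.
exists psi; split=> // i j ij; apply: gR; apply: leq_trans (psi_mono _ _ ij).
by rewrite /psi /= /h leq_max leqnn orbT.
Qed.

End Tails.

(** * Gliding hump *)

Section FiniteSpans.
Variables (F : numFieldType) (V : normedModType F).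
Hypothesis discs : compact_discs F.

Lemma totally_bounded_disc_scale (r : F) (y : V) :
  totally_bounded [set a *: y | a in [set a : F | `|a| <= r]].
Proof.
move=> e e0; have y1 : 0 < `|y| + 1 by rewrite ltr_wpDl.
have tD : totally_bounded [set a : F^o | `|a| <= r].
  by apply: compact_totally_bounded; exact: discs.
have [|s sP] := tD (e / (`|y| + 1)); first exact: divr_gt0.
exists [seq a *: y | a <- s] => _ [a /= ar <-]; have [b bs ab] := sP a ar.
exists (b *: y); first exact: (map_f (fun c : F => c *: y)).
rewrite -scalerBl normrZ; apply: (@le_lt_trans _ _ (`|a - b| * (`|y| + 1))).
  by rewrite ler_wpM2l// lerDl.
by rewrite -ltr_pdivlMr.
Qed.

Lemma totally_boundedD (A B : set V) : totally_bounded A -> totally_bounded B ->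
  totally_bounded [set x + y | x in A & y in B].
Proof.
move=> tA tB e e0; have e2 : 0 < e / 2 by exact: divr_gt0.
have [s sA] := tA _ e2; have [t tB'] := tB _ e2.
exists [seq x + y | x <- s, y <- t] => _ [x Ax [y By <-]].
have [x' xs xx] := sA _ Ax; have [y' yt yy] := tB' _ By.
exists (x' + y'); first exact: (allpairs_f (fun x y => x + y)).
by rewrite opprD addrACA (le_lt_trans (ler_normD _ _))// [ltRHS]splitr ltrD.
Qed.

Lemma totally_bounded_span (r : F) (f : nat -> V) n : totally_bounded
  [set x | exists2 a : nat -> F, forall i, (i < n)%N -> `|a i| <= r &
    x = \sum_(i < n) a i *: f i].
Proof.
elim: n => [|n IH].
  move=> e e0; exists [:: 0] => _ [a _ ->]; exists 0; first by rewrite inE.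
  by rewrite big_ord0 subrr normr0.
apply: totally_bounded_sub (totally_boundedD IH (totally_bounded_disc_scale r (f n))).
move=> _ [a ar ->]; rewrite big_ord_recr /=.
exists (\sum_(i < n) a i *: f i); first by exists a => // i ni; rewrite ar// ltnW.
by exists (a n *: f n) => //; exists (a n) => //=; rewrite ar.
Qed.

(** If [tau] were small on some tail, [tau u] would be close to [tau (trunc n u)], which ranges over
    a bounded part of a finite-dimensional span, a totally bounded set. *)
Lemma noncompact_tails (tau : c0 F -> V) (C : F) : bounded_ops (c0 F) V tau ->
  0 < C -> ~ totally_bounded (tau @` [set u | `|u| <= C]) ->
  exists2 d : F, 0 < d & forall n, exists u : c0 F,
    [/\ forall i, (i < n)%N -> val u i = 0, `|u| <= 1 & d <= `|tau u|].
Proof.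
move=> /bounded_ops_linear[f ->] C0 ntb; apply: contrapT => ntail; apply: ntb.
move=> e e0; have e2 : 0 < e / 2 by exact: divr_gt0.
have d0 : 0 < e / 2 / C by exact: divr_gt0.
have [n nP] : exists n, forall u : c0 F, (forall i, (i < n)%N -> val u i = 0) ->
    `|u| <= 1 -> `|f u| < e / 2 / C.
  apply: contrapT => h; apply: ntail; exists (e / 2 / C) => // n.
  apply: contrapT => h'; apply: h; exists n => u un u1.
  rewrite real_ltNge ?normr_real ?gtr0_real//; apply/negP => du.
  by apply: h'; exists u.
have [s sP] := totally_bounded_span C (fun k => f (unit_vec F k)) n e2.
exists s => _ [u /= uC <-].
have [|y ys uy] := sP (f (trunc n u)).
  exists (val u); first by move=> i _; exact: le_trans (c0_norm_ge _ _) uC.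
  by rewrite trunc_sum linear_sum; apply: eq_bigr => i _; rewrite linearZ.
exists y => //; rewrite (le_lt_trans (ler_distD (f (trunc n u)) _ _))//.
rewrite [ltRHS]splitr ltrD// -linearB.
have : `|f (C^-1 *: (u - trunc n u))| < e / 2 / C.
  apply: nP => [i ni|].
    rewrite -[LHS]/(C^-1 * (val u i - val (trunc n u) i)).
    by rewrite truncE ni subrr mulr0.
  rewrite normrZ normfV gtr0_norm// mulrC ler_pdivrMr// mul1r.
  exact: le_trans (trunc_tail_norm _ _) uC.
by rewrite linearZ normrZ normfV gtr0_norm// mulrC ltr_pM2r ?invr_gt0.
Qed.

End FiniteSpans.

(** * Approximate factorization of the identity of c_0 *)

Section FixingNullSequences.
Variables (F : numFieldType) (K : compactSpaceType).
Hypothesis arch : archimedean_norm F.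
Hypothesis discs : compact_discs F.
Local Notation X := (CK K F).
Local Notation c0 := (c0 F).
Variable pts : nat -> K.

(** Density of the points, stated as an estimate; in a Mrowka space they are the copies of the
    natural numbers. *)
Definition norming := forall (f : X) (c : F),
  (forall n, `|val f (pts n)| <= c) -> `|f| <= c.

(* Convergence of a subsequence to q in K, expressed through the functions in X. *)
Definition subsequentially_convergent := forall t : nat -> nat,
  (forall k, (t k < t k.+1)%N) ->
  exists phi q, (forall k, (phi k < phi k.+1)%N) /\
    forall f : X, null_seq (fun k => val f (pts (t (phi k))) - val f q).

Hypothesis pts_norming : norming.
Hypothesis pts_subseq : subsequentially_convergent.

Section Bumps.
Variables (tau : c0 -> X) (d : F).
Hypothesis tau_bounded : bounded_ops c0 X tau.
Hypothesis d0 : 0 < d.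
Hypothesis tau_tails : forall n, exists u : c0,
  [/\ forall i, (i < n)%N -> val u i = 0, `|u| <= 1 & d <= `|tau u|].

Let bounded_ev t : bounded_ops c0 F^o (evaluation t \o tau).
Proof. exact: bounded_ops_comp (bounded_evaluation _ _) tau_bounded. Qed.

(** A vector far enough in the tail has values at most [d / 4] at the first [T + 1] points, so its
    image is large only at a later point. *)
Lemma bump_exists n T : exists (u : c0) m t,
  [/\ forall i, val u i != 0 -> (n <= i < m)%N, `|u| <= 1, (T < t)%N &
      d / 2 <= `|val (tau u) (pts t)|].
Proof.
have d4 : 0 < d / 4%:R by rewrite divr_gt0 ?ltr0n.
have /choice[N NP] := fun t => functional_tail arch (bounded_ev (pts t)) d4.
pose M := maxn n (\max_(t < T.+1) N t).
have [u [uM u1 du]] := tau_tails M.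
have [C C0 tC] := bounded_ops_bound tau_bounded.
have e0 : 0 < d / 4%:R / C by rewrite divr_gt0.
have [m /(_ m (leqnn m)) um] := trunc_cvg u e0.
have tu : d / 2 < `|tau (trunc m u)|.
  have [f fE] := bounded_ops_linear tau_bounded.
  have : `|tau (u - trunc m u)| < d / 4%:R.
    by rewrite (le_lt_trans (tC _))// mulrC -ltr_pdivlMr.
  rewrite fE linearB -fE => h.
  have : d < d / 4%:R + `|tau (trunc m u)|.
    rewrite (le_lt_trans du)// -{1}(subrK (tau (trunc m u)) (tau u)).
    by rewrite (le_lt_trans (ler_normD _ _))// ltrD2r.
  rewrite -ltrBlDl; apply: lt_trans.
  rewrite -subr_gt0 (_ : _ - _ = d / 4%:R)//; by field.
have [t dt] : exists t, d / 2 < `|val (tau (trunc m u)) (pts t)|.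
  apply: contrapT => h; suff : `|tau (trunc m u)| <= d / 2.
    by move=> /(lt_le_trans tu); rewrite ltxx.
  apply: pts_norming => t; rewrite real_leNgt ?normr_real ?gtr0_real ?divr_gt0//.
  by apply/negP => dt; apply: h; exists t.
exists (trunc m u), m, t; split.
- move=> i; rewrite truncE; case: ltnP => im; last by rewrite eqxx.
  rewrite andbT => ui; rewrite leqNgt; apply: contra ui => ni.
  by rewrite uM// (leq_trans ni)// leq_maxl.
- exact: le_trans (trunc_norm _ _) u1.
- rewrite ltnNge; apply/negP => tT.
  have : `|val (tau (trunc m u)) (pts t)| <= d / 4%:R * `|trunc m u|.
    apply: (NP t) => i it; rewrite truncE; case: ifP => // _; apply: uM.
    rewrite (leq_trans it)// leq_max; apply/orP; right.
    by rewrite -ltnS in tT; rewrite (leq_bigmax (Ordinal tT)).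
  move=> /(lt_le_trans dt); apply/negP; rewrite -real_leNgt; last first.
  - by rewrite gtr0_real// divr_gt0.
  - by rewrite realM ?normr_real ?gtr0_real.
  have t1 : `|trunc m u| <= 1 by exact: le_trans (trunc_norm _ _) u1.
  have d4' := ltW d4; rewrite (le_trans (ler_piMr _ t1))//.
  by rewrite ler_pM2l// lef_pV2 ?posrE ?ltr0n// ler_nat.
- exact: ltW.
Qed.

Lemma bump_sequence : exists (u : nat -> c0) (n t : nat -> nat),
  [/\ forall k i, val (u k) i != 0 -> (n k <= i < n k.+1)%N,
      forall k, `|u k| <= 1,
      forall k, (n k < n k.+1)%N, forall k, (t k < t k.+1)%N &
      forall k, d / 2 <= `|val (tau (u k)) (pts (t k))|].
Proof.
have /choice[g gP] : forall p : nat * nat, exists q : c0 * (nat * nat),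
    [/\ forall i, val q.1 i != 0 -> (p.1 <= i < q.2.1)%N, `|q.1| <= 1,
      (p.2 < q.2.2)%N & d / 2 <= `|val (tau q.1) (pts q.2.2)|].
  by move=> p; have [u [m [t h]]] := bump_exists p.1 p.2; exists (u, (m, t)).
(* The state holds the end of the last support and the index of the last point. *)
pose st k := iter k (fun p => (g p).2) (0%N, 0%N).
exists (fun k => (g (st k)).1), (fun k => (st k).1), (fun k => (st k.+1).2).
split=> [k i|k|k|k|k]; last 1 first.
- by have [] := gP (st k).
- by have [h _ _ _] := gP (st k); exact: h.
- by have [] := gP (st k).
- have [h _ _ dk] := gP (st k).
  (* An empty interval would make the bump zero, against the lower bound on its image. *)
  rewrite ltnNge; apply/negP => le; have : (g (st k)).1 = 0.
    apply: c0_ext => i; apply/eqP/negPn/negP => /h /andP[ki ik].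
    by have := leq_trans ik (leq_trans le ki); rewrite ltnn.
  have [f fE] := bounded_ops_linear tau_bounded.
  move=> g0; move: dk; rewrite g0 fE linear0 normr0.
  by apply/negP; rewrite lt_geF ?divr_gt0.
- by have [] := gP (st k.+1).
Qed.

(** The matrix of the functionals against the images of the bumps is nearly diagonal: extraction
    makes the entries from earlier bumps summably small, and tail estimates bound all later bumps
    together. [V] divides by the diagonal entries [D j]. *)
Lemma c0_identity_approx (e : F) : 0 < e ->
  exists (B : c0 -> c0) (V : X -> c0),
    [/\ bounded_ops c0 c0 B, bounded_ops X c0 V &
        forall u, `|V (tau (B u)) - u| <= e * `|u|].
Proof.
move=> e0; have [u [n [t [usupp u1 nlt tlt du]]]] := bump_sequence.
have [phi [q [philt phicvg]]] := pts_subseq tlt.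
(* Subtracting the value at the limit [q] makes these functionals tend to 0 on every function, so
   that [V] takes values in c_0. *)
pose chi k (f : X) : F^o := val f (pts (t (phi k))) - val f q.
have chi_norm k f : `|chi k f| <= 2 * `|f|.
  by rewrite (le_trans (ler_normB _ _))// mulr_natl mulr2n lerD ?CK_norm_ge.
have chi_bounded k : bounded_ops X F^o (chi k).
  apply: (@bounded_opsI _ _ _ _ 2) => // a f g; rewrite /chi.
  rewrite -[val (_ + _) _]/(a * val f (pts (t (phi k))) + val g (pts (t (phi k)))).
  rewrite -[val (_ + _) q]/(a * val f q + val g q).
  by rewrite opprD addrACA -mulrBr.
have [f fE] := bounded_ops_linear tau_bounded.
pose c := d / 4%:R; have c0 : 0 < c by rewrite divr_gt0 ?ltr0n.
have ec0 : 0 < e * c / 2 by rewrite divr_gt0// mulr_gt0.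
(* Images of bumps beyond [Nq] have value at most [c] at [q], which leaves [d / 2 - c = c] as a
   lower bound for the diagonal. *)
have [Nq Nq_tail] := functional_tail arch (bounded_ev q) c0.
have /choice[N N_tail] := fun k =>
  functional_tail arch (bounded_ops_comp (chi_bounded k) tau_bounded) ec0.
have n_ge k j : (k <= j)%N -> (k <= n (phi j))%N.
  move=> /leq_trans; apply; apply: leq_trans (incr_ge nlt _).
  exact: incr_ge.
(* For an earlier [l] and a later [k], functional [k] is small on the image of bump [l], and bump
   [k] lies in the tail controlled for functional [l]. *)
have [|psi [psi0 psilt psiR]] := @eventually_select
  (fun l k => `|chi k (tau (u (phi l)))| <= e * c / 2 / 2 ^+ l.+1 /\
    (N l <= n (phi k))%N) Nq.
  move=> l; have [|M Mchi] := phicvg (tau (u (phi l))) (e * c / 2 / 2 ^+ l.+1).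
    by rewrite divr_gt0// exprn_gt0.
  exists (maxn M (N l)) => k; rewrite geq_max => /andP[Mk Nk].
  by split; [exact/ltW/Mchi|exact: n_ge].
pose v j := u (phi (psi j)); pose s j := n (phi (psi j)).
pose D j := chi (psi j) (tau (v j)).
have phi_mono := incr_homo philt.
have slt j : (s j < s j.+1)%N.
  apply: leq_trans (nlt _) _; apply: incr_homo => //.
  by apply: leq_trans (philt _) _; exact: phi_mono.
have vsupp j i : val (v j) i != 0 -> (s j <= i < s j.+1)%N.
  move=> /usupp /andP[-> ij] /=; apply: leq_trans ij _; apply: incr_homo => //.
  by apply: leq_trans (philt _) _; exact: phi_mono.
have D_ge j : c <= `|D j|.
  have vq : `|val (tau (v j)) q| <= c.
    apply: (@le_trans _ _ (c * `|v j|)); last by rewrite ler_piMr ?u1// ltW.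
    apply: Nq_tail => i iN; apply/eqP/negPn/negP => /vsupp /andP[ji _].
    have := leq_ltn_trans ji iN; rewrite ltnNge; case/negP; apply: n_ge.
    by apply: leq_trans psi0 _; exact: incr_homo.
  have := du (phi (psi j)); rewrite -/(v j) => dv.
  rewrite -(lerD2r c); have <- : d / 2 = c + c by rewrite /c; field.
  rewrite (le_trans dv)// -(subrK (val (tau (v j)) q) (val _ (pts _))).
  by rewrite (le_trans (ler_normD _ _))// lerD.
have D0 j : D j != 0 by rewrite -normr_gt0 (lt_le_trans c0).
pose V (g : X) := mkc0 (fun j => chi (psi j) g / D j).
have VE g j : val (V g) j = chi (psi j) g / D j.
  rewrite mkc0E// => x x0; have [|M Mg] := phicvg g (x * c).
    by rewrite mulr_gt0.
  exists M => k Mk; rewrite normrM normfV ltr_pdivrMr ?normr_gt0//.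
  apply: lt_le_trans (Mg (psi k) _) _; last by rewrite ler_pM2l.
  by apply: leq_trans Mk _; exact: incr_ge.
exists (block_op v slt), V; split.
- by apply: bounded_block_op => j; exact: u1.
- apply: (@coordinatewise_bounded _ _ _ (2 / c)) => [||x i].
  + by rewrite divr_ge0// ltW.
  + move=> i a x y; rewrite /= !VE.
    by have [-> _] := chi_bounded (psi i); rewrite mulrDl -mulrA.
  + rewrite VE normrM normfV ler_pdivrMr ?normr_gt0//.
    rewrite (le_trans (chi_norm _ _))// mulrAC ler_wpM2r//.
    rewrite mulrAC ler_pdivlMr// ler_pM2l//.
move=> x; apply: c0_norm_le => j.
rewrite -[val _ j]/(val (V (tau (block_op v slt x))) j - val x j) VE.
(* The image splits into earlier bumps, the diagonal term and a tail; the first and the last each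
   cost half of the error. *)
have [r [-> r0 rx]] := block_op_split slt (fun j => u1 _) vsupp x j.
have [g gE] := bounded_ops_linear (chi_bounded (psi j)).
rewrite big_ord_recr /= fE !linearD gE !linearD linear_sum linear_sum !linearZ /=.
rewrite -[X in (_ + X + _) / _]/(val x j * g (f (v j))).
have -> : g (f (v j)) = D j by rewrite /D fE gE.
set S := \sum_(_ < _) _; rewrite addrAC mulrDl mulfK// addrK normrM normfV.
rewrite ler_pdivrMr ?normr_gt0//.
apply: (@le_trans _ _ (e * `|x| * c)); last first.
  by rewrite ler_wpM2l// mulr_ge0// ltW.
have -> : e * `|x| * c = e * c / 2 * `|x| + e * c / 2 * `|x| by field.
rewrite (le_trans (ler_normD _ _))// lerD//; last first.
  rewrite -gE -fE; apply: (@le_trans _ _ (e * c / 2 * `|r|)).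
    apply: N_tail => i iN; apply: r0; apply: leq_trans iN _.
    by have [] := psiR _ _ (ltnSn j).
  by rewrite ler_pM2l.
rewrite /S (le_trans (ler_norm_sum _ _ _))//.
apply: (@le_trans _ _ (\sum_(i < j) e * c / 2 * `|x| / 2 ^+ i.+1)).
  apply: ler_sum => i _; rewrite !linearZ /= normrM -gE -fE [leRHS]mulrAC mulrC.
  apply: ler_pM => //; last exact: c0_norm_ge.
  have [h _] := psiR i j (ltn_ord i); apply: le_trans h _.
  rewrite ler_pM2l// lef_pV2 ?posrE ?exprn_gt0//.
  by rewrite ler_weXn2l ?ler1n// ltnS; exact: incr_ge.
rewrite -mulr_sumr ler_piMr//; first by rewrite mulr_ge0// ltW.
have -> : \sum_(i < j) (2 : F) ^- i.+1 = 1 - 2 ^- j.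
  elim: j {D0 D_ge g gE r r0 rx S} => [|j IH]; first by rewrite big_ord0 expr0 invr1 subrr.
  rewrite big_ord_recr /= IH exprS; have : (2 : F) ^+ j != 0 by rewrite expf_neq0 ?pnatr_eq0.
  by move=> h; field.
by rewrite gerBl invr_ge0 exprn_ge0.
Qed.

End Bumps.

End FixingNullSequences.

(** * Closed ideals *)

Section Subspaces.
Variables (F : numFieldType) (V : normedModType F).

Definition mem_subspace (W : linear_subspace V) (x : V) (Wx : subspace_set W x) :
    subspace_space W :=
  exist (fun y => subspace_pred W y) x (asboolT Wx).

Lemma subspaceW (W : linear_subspace V) (w : subspace_space W) : subspace_set W (val w).
Proof. exact/asboolP/(valP w). Qed.

Lemma bounded_subspace_val (W : linear_subspace V) :
  bounded_ops (subspace_space W) V (fun w => val w).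
Proof. by apply: (@bounded_opsI _ _ _ _ 1) => // x; rewrite mul1r. Qed.

Lemma bounded_ops_corestrict (U : normedModType F) (W : linear_subspace V)
    (T : U -> V) (TW : forall x, subspace_set W (T x)) :
  bounded_ops U V T -> bounded_ops U (subspace_space W) (fun x => mem_subspace (TW x)).
Proof.
move=> /bounded_opsP[f [fE [C C0 fC]]].
apply: (@bounded_opsI _ _ _ _ C) => [a x y||x]; last 2 first.
- exact: ltW.
- by rewrite -[leLHS]/`|T x| fE.
- by apply: val_inj; rewrite /= fE linearP.
Qed.

Lemma range_subspaceP (U : normedModType F) (T : U -> V) : linear T ->
  exists E : linear_subspace V, (E : set V) = range T.
Proof.
move=> /linear_bundle[f ->].
have E0 : range f 0 by exists 0 => //; rewrite linear0.
have EP (a : F) x y : range f x -> range f y -> range f (a *: x + y).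
  by move=> [u _ <-] [v _ <-]; exists (a *: u + v) => //; rewrite linearP.
by exists (Subspace E0 EP).
Qed.

Lemma sum_widen (a : nat -> F) (f : nat -> V) n m : (n <= m)%N ->
  \sum_(i < n) a i *: f i = \sum_(i < m) (if (i < n)%N then a i else 0) *: f i.
Proof.
move=> nm; rewrite (big_ord_widen m (fun i => a i *: f i) nm) big_mkcond /=.
by apply: eq_bigr => i _; case: ifP => _ //; rewrite scale0r.
Qed.

Lemma span_subspaceP (f : nat -> V) : exists E : linear_subspace V,
  (E : set V) = [set x | exists n (a : nat -> F), x = \sum_(i < n) a i *: f i].
Proof.
set S := [set x | _].
have S0 : S 0 by exists 0%N, (fun=> 0); rewrite big_ord0.
have SP (c : F) x y : S x -> S y -> S (c *: x + y).
  move=> [n [a ->]] [m [b ->]].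
  exists (maxn n m), (fun i => c * (if (i < n)%N then a i else 0) +
    (if (i < m)%N then b i else 0)).
  rewrite (sum_widen _ _ (leq_maxl n m)) (sum_widen _ _ (leq_maxr n m)).
  rewrite scaler_sumr -big_split /=; apply: eq_bigr => i _.
  by rewrite scalerA scalerDl.
by exists (Subspace S0 SP).
Qed.

End Subspaces.

(** * The zero, compact, separable-range and full ideals *)

Section Operators.
Variables (F : numFieldType) (K : compactSpaceType).
Hypothesis arch : archimedean_norm F.
Hypothesis discs : compact_discs F.
Local Notation X := (CK K F).
Local Notation c0 := (c0 F).

Lemma compact_opsP (T : X -> X) : compact_ops X T <->
  bounded_ops X X T /\ totally_bounded (T @` [set x | `|x| <= 1]).
Proof.
by split=> -[bT h]; split=> //; [exact/(precompactP discs)|exact/(precompactP discs)].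
Qed.

Lemma separable_range_opsP (T : X -> X) : separable_range_ops X T <->
  bounded_ops X X T /\ seq_dense (range T).
Proof. by split=> -[bT h]; split=> //; apply/separableP. Qed.

Lemma c0_factoring_separable (T : X -> X) :
  c0_factoring_ops X T -> separable_range_ops X T.
Proof.
move=> [R [S [bR bS ->]]]; apply/separable_range_opsP; split.
  exact: bounded_ops_comp.
have [d dP] := c0_seq_dense arch discs; exists (S \o d) => _ [x _ <-] e e0.
have [C C0 SC] := bounded_ops_bound bS; have [f fE] := bounded_ops_linear bS.
have [n xn] := dP (R x) I _ (divr_gt0 e0 C0); exists n => /=.
by rewrite fE -linearB -fE (le_lt_trans (SC _))// mulrC -ltr_pdivlMr.
Qed.

(** The range is a countable union of images of balls of integer radius, each contained in a dilate
    of a totally bounded set. *)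
Lemma compact_ops_separable (T : X -> X) :
  compact_ops X T -> separable_range_ops X T.
Proof.
move=> /compact_opsP[bT tT]; apply/separable_range_opsP; split=> //.
have [f fE] := bounded_ops_linear bT.
have h n : seq_dense (T @` [set x | `|x| <= n%:R]).
  apply: totally_bounded_seq_dense => // e e0.
  have e1 : 0 < e / n.+1%:R by rewrite divr_gt0 ?ltr0n.
  have [s sP] := tT _ e1; exists [seq n.+1%:R *: y | y <- s] => _ [x /= xn <-].
  have [|y ys xy] := sP (T (n.+1%:R^-1 *: x)).
    exists (n.+1%:R^-1 *: x) => //=; rewrite normrZ gtr0_norm ?invr_gt0//.
    rewrite mulrC ler_pdivrMr ?ltr0n// mul1r (le_trans xn)// ler_nat.
    exact: leqnSn.
  exists (n.+1%:R *: y); first exact: (map_f (fun z : X => n.+1%:R *: z)).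
  move: xy; rewrite fE linearZ ltr_pdivlMr ?ltr0n// mulrC.
  rewrite -[X in X * _](@gtr0_norm _ n.+1%:R) ?ltr0n// -normrZ scalerBr scalerA.
  by rewrite divff ?scale1r// pnatr_eq0.
apply: seq_dense_sub (seq_dense_bigcup h) => _ [x _ <-].
by have [n xn] := arch `|x|; exists n => //; exists x => //=; rewrite -(normr_id x) ltW.
Qed.

Lemma closed_ideal_zero : closed_ideal [set (0 : X -> X)].
Proof.
split.
- by move=> _ ->; exact: bounded_ops0.
- split=> // [T S -> ->|a T ->]; rewrite /=; first by rewrite addr0.
  by rewrite scaler0.
- move=> T U V -> [lU _] _; apply/funext => x; have [f fE] := linear_bundle lU.
  by rewrite /= fE; exact: linear0.
- move=> T bT h; apply/funext => x; apply/eqP; rewrite -normr_eq0.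
  have [//|] := eqVneq `|T x| 0; rewrite normr_eq0 => Tx0.
  have [C C0 TC] := bounded_ops_bound bT.
  have x0 : 0 < `|x|.
    rewrite normr_gt0; apply: contraNneq Tx0 => ->.
    by have [f ->] := bounded_ops_linear bT; rewrite linear0.
  have e0 : 0 < `|T x| / 2 / `|x|.
    by rewrite divr_gt0// divr_gt0// normr_gt0.
  have [S -> /(_ x)] := h _ e0; rewrite divfK ?gt_eqF//.
  rewrite -[_ - _]/(T x - 0) subr0 ler_pdivlMr// ger_pMr ?normr_gt0//.
  by rewrite lern1.
Qed.

Lemma closed_ideal_all : closed_ideal (bounded_ops X X).
Proof.
split=> //.
- split; [exact: bounded_ops0|by move=> T S; exact: bounded_opsD|].
  by move=> a T; exact: bounded_opsZ.
- by move=> T U V bT bU bV; apply: bounded_ops_comp bV; exact: bounded_ops_comp.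
Qed.

Lemma closed_ideal_separable : closed_ideal (separable_range_ops X).
Proof.
split.
- by move=> T [].
- split=> [|T S /separable_range_opsP[bT sT] /separable_range_opsP[bS sS]|].
  + apply/separable_range_opsP; split; first exact: bounded_ops0.
    by exists (fun=> 0) => _ [x _ <-] e e0; exists 0%N; rewrite subrr normr0.
  + apply/separable_range_opsP; split; first exact: bounded_opsD.
    apply: seq_dense_sub (seq_denseD sT sS) => _ [x _ <-].
    by exists (T x); [exists x|exists (S x); [exists x|]].
  + move=> a T /separable_range_opsP[bT [d dT]]; apply/separable_range_opsP.
    split; first exact: bounded_opsZ.
    exists (fun n => a *: d n) => _ [x _ <-] e e0.
    have a0 : 0 < `|a| + 1 by rewrite ltr_wpDl.
    have [|n xn] := dT (T x) _ _ (divr_gt0 e0 a0); first by exists x.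
    exists n; rewrite -[a *: T]/(fun x => a *: T x) -scalerBr normrZ.
    apply: (@le_lt_trans _ _ ((`|a| + 1) * `|T x - d n|)).
      by rewrite ler_wpM2r// lerDl.
    by rewrite mulrC -ltr_pdivlMr.
- move=> T U V /separable_range_opsP[bT [d dT]] bU bV.
  apply/separable_range_opsP; split.
    by apply: bounded_ops_comp bV; exact: bounded_ops_comp.
  exists (U \o d) => _ [x _ <-] e e0.
  have [C C0 UC] := bounded_ops_bound bU; have [f fE] := bounded_ops_linear bU.
  have [|n xn] := dT (T (V x)) _ _ (divr_gt0 e0 C0); first by exists (V x).
  by exists n; rewrite /= fE -linearB -fE (le_lt_trans (UC _))// mulrC -ltr_pdivlMr.
- move=> T bT h; apply/separable_range_opsP; split=> //.
  have /choice[S SP] : forall n, exists S, separable_range_ops X S /\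
      forall x, `|T x - S x| <= n.+1%:R^-1 * `|x|.
    by move=> n; have [|S IS TS] := h n.+1%:R^-1; [rewrite invr_gt0|exists S].
  have sS n : seq_dense (range (S n)).
    by have [/separable_range_opsP[]] := SP n.
  have [d dP] := seq_dense_bigcup sS; exists d => _ [x _ <-] e e0.
  have e2 : 0 < e / 2 by exact: divr_gt0.
  have x1 : 0 < `|x| + 1 by rewrite ltr_wpDl.
  have [n ne] := archi_inv_lt arch (divr_gt0 e2 x1).
  have [|m xm] := dP (S n x) _ _ e2; first by exists n => //; exists x.
  exists m; rewrite (le_lt_trans (ler_distD (S n x) _ _))// [ltRHS]splitr.
  apply: ltrD xm; have [_ TS] := SP n; apply: le_lt_trans (TS x) _.
  apply: (@le_lt_trans _ _ (n.+1%:R^-1 * (`|x| + 1))).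
    by rewrite ler_wpM2l ?invr_ge0// lerDl.
  by rewrite -ltr_pdivlMr.
Qed.

Lemma totally_bounded_image (V W : normedModType F) (f : V -> W) (A : set V) :
  bounded_ops V W f -> totally_bounded A -> totally_bounded (f @` A).
Proof.
move=> bf tA e e0; have [C C0 fC] := bounded_ops_bound bf.
have [s sP] := tA _ (divr_gt0 e0 C0); exists (map f s) => _ [x Ax <-].
have [y ys xy] := sP _ Ax; exists (f y); first exact: map_f.
have [g gE] := bounded_ops_linear bf.
by rewrite gE -linearB -gE (le_lt_trans (fC _))// mulrC -ltr_pdivlMr.
Qed.

Lemma closed_ideal_compact : closed_ideal (compact_ops X).
Proof.
split.
- by move=> T [].
- split=> [|T S /compact_opsP[bT tT] /compact_opsP[bS tS]|].
  + apply/compact_opsP; split; first exact: bounded_ops0.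
    move=> e e0; exists [:: 0] => _ [x _ <-]; exists 0; first by rewrite inE.
    by rewrite subrr normr0.
  + apply/compact_opsP; split; first exact: bounded_opsD.
    apply: totally_bounded_sub (totally_boundedD tT tS) => _ [x x1 <-].
    by exists (T x); [exists x|exists (S x); [exists x|]].
  + move=> a T /compact_opsP[bT tT]; apply/compact_opsP.
    split; first exact: bounded_opsZ.
    have ba := bounded_opsZ a (bounded_ops_id X).
    apply: totally_bounded_sub (totally_bounded_image ba tT) => _ [x x1 <-].
    by exists (T x) => //; exists x.
- move=> T U V /compact_opsP[bT tT] bU bV; apply/compact_opsP; split.
    by apply: bounded_ops_comp bV; exact: bounded_ops_comp.
  have [C C0 VC] := bounded_ops_bound bV.
  (* The bound of [V] is moved to [U]: [U T V = (C U) T (C^-1 V)], and [C^-1 V] preserves the unit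
     ball. *)
  have bCU := bounded_opsZ C bU.
  apply: totally_bounded_sub (totally_bounded_image bCU tT) => _ [x /= x1 <-].
  exists (T (C^-1 *: V x)).
    exists (C^-1 *: V x) => //=.
    rewrite normrZ gtr0_norm ?invr_gt0// mulrC ler_pdivrMr// mul1r.
    by rewrite (le_trans (VC x))// ler_piMr// ltW.
  have [f ->] := bounded_ops_linear bT; have [g ->] := bounded_ops_linear bU.
  rewrite -[LHS]/(C *: g (f (C^-1 *: V x))) linearZ /= linearZ /= scalerA.
  by rewrite divff ?scale1r// gt_eqF.
- move=> T bT h; apply/compact_opsP; split=> // e e0.
  have e2 : 0 < e / 2 by exact: divr_gt0.
  have [S /compact_opsP[_ /(_ _ e2)[s sP]] TS] := h _ e2.
  exists s => _ [x /= x1 <-]; have [|y ys xy] := sP (S x); first by exists x.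
  exists y => //; rewrite (le_lt_trans (ler_distD (S x) _ _))// [ltRHS]splitr.
  by apply: ler_ltD xy; rewrite (le_trans (TS x))// ler_piMr// ltW.
Qed.

End Operators.

(** * Non-compact operators fix null sequences *)

Section Ideals.
Variables (F : numFieldType) (K : compactSpaceType).
Hypothesis arch : archimedean_norm F.
Hypothesis discs : compact_discs F.
Local Notation X := (CK K F).
Local Notation c0 := (c0 F).
Variable pts : nat -> K.
Hypothesis pts_norming : norming F pts.
Hypothesis pts_subseq : subsequentially_convergent F pts.
Hypothesis separable_in_c0 : forall E : linear_subspace X,
  separable (E : set X) ->
  exists2 W : linear_subspace X, E `<=` W & isomorphic (subspace_space W) c0.

Lemma noncompact_sequence (T : X -> X) : bounded_ops X X T -> ~ compact_ops X T ->
  exists2 d : F, 0 < d & exists f : nat -> X, (forall n, `|f n| <= 1) /\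
    forall m n, (m < n)%N -> ~ `|T (f n) - T (f m)| < d.
Proof.
move=> bT nT; have {nT} : ~ totally_bounded (T @` [set x | `|x| <= 1]).
  by move=> tT; apply: nT; apply/(compact_opsP discs).
move=> ntb; have [d [d0 dP]] : exists d : F, 0 < d /\ forall s : seq X,
    exists x : X, `|x| <= 1 /\ forall y, y \in s -> ~ `|T x - y| < d.
  apply: contrapT => h; apply: ntb => d d0; apply: contrapT => h'; apply: h.
  exists d; split=> // s; apply: contrapT => h; apply: h'; exists s.
  move=> _ [x /= x1 <-]; apply: contrapT => h'; apply: h; exists x; split=> // y ys xy.
  by apply: h'; exists y.
have /choice[g gP] := dP; exists d => //.
(* Greedy choice: the list of all earlier images is never a net of radius [d], so a new vector can
   be found. *)
pose l k := iter k (fun s => T (g s) :: s) [::].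
exists (fun k => g (l k)); split=> [n|m n mn]; first by have [] := gP (l n).
have [_] := gP (l n); apply; elim: n mn => // n IH; rewrite ltnS leq_eqVlt.
by move=> /predU1P[->|/IH h]; rewrite inE ?eqxx// h orbT.
Qed.

(* A bounded sequence on which T is separated spans a separable subspace, hence
   lies in a copy of c_0, on which T is not compact. *)
Lemma noncompact_fixes_c0 (T : X -> X) (e : F) :
  bounded_ops X X T -> ~ compact_ops X T -> 0 < e ->
  exists (U : c0 -> X) (V : X -> c0),
    [/\ bounded_ops c0 X U, bounded_ops X c0 V &
        forall u, `|V (T (U u)) - u| <= e * `|u|].
Proof.
move=> bT nT e0; have [d d0 [f [f1 fsep]]] := noncompact_sequence bT nT.
have [E ES] := span_subspaceP f.
have sE : separable (E : set X).
  by rewrite ES; apply/separableP => //; exact: span_seq_dense.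
have [W EW [j [s [bj bs sj js]]]] := separable_in_c0 sE.
have fW n : subspace_set W (f n).
  apply: EW; rewrite ES; exists n.+1, (fun i => (i == n)%:R).
  rewrite big_ord_recr /= eqxx scale1r big1 ?add0r// => i _.
  by rewrite ltn_eqF// scale0r.
pose iota (u : c0) : X := val (s u); pose g n := j (mem_subspace (fW n)).
have ig n : iota (g n) = f n by rewrite /iota /g sj.
have biota : bounded_ops c0 X iota.
  exact: bounded_ops_comp (bounded_subspace_val W) bs.
have btau : bounded_ops c0 X (T \o iota) by exact: bounded_ops_comp.
have [C C0 jC] := bounded_ops_bound bj.
have gC n : `|g n| <= C.
  by have C0' := ltW C0; rewrite (le_trans (jC _))// ler_piMr// f1.
have ntb : ~ totally_bounded ((T \o iota) @` [set u | `|u| <= C]).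
  move=> tb; apply: (totally_bounded_separated d0 tb (x := T \o f)) => n.
    by exists (g n) => //=; rewrite ig.
  exact: fsep.
have [c c0' ctail] := noncompact_tails discs btau C0 ntb.
have [B [V [bB bV VB]]] :=
  c0_identity_approx arch pts_norming pts_subseq btau c0' ctail e0.
by exists (iota \o B), V; split=> //; exact: bounded_ops_comp.
Qed.

(** [R] is [T] read in a copy of c_0 containing its range. The last clause transfers estimates on
    values of [T] to [R]. *)
Lemma separable_range_factors (T : X -> X) : separable_range_ops X T ->
  exists (R : X -> c0) (S : c0 -> X),
    [/\ bounded_ops X c0 R, bounded_ops c0 X S, T = S \o R &
     exists2 C : F, 0 < C & forall x y, `|R x - R y| <= C * `|T x - T y|].
Proof.
move=> [bT sT]; have [E ER] := range_subspaceP bT.1.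
have [|W EW [j [s [bj bs sj js]]]] := @separable_in_c0 E; first by rewrite ER.
have TW x : subspace_set W (T x) by apply: EW; rewrite ER; exists x.
exists (fun x => j (mem_subspace (TW x))), (fun u => val (s u)); split.
- exact: bounded_ops_comp bj (bounded_ops_corestrict TW bT).
- exact: bounded_ops_comp (bounded_subspace_val W) bs.
- by apply/funext => x /=; rewrite sj.
have [C C0 jC] := bounded_ops_bound bj; exists C => // x y.
have [f fE] := bounded_ops_linear bj; rewrite fE -linearB -fE.
exact: le_trans (jC _) _.
Qed.

Lemma separable_range_opsE : separable_range_ops X = c0_factoring_ops X.
Proof.
apply/seteqP; split=> T; last exact: c0_factoring_separable.
by move=> /separable_range_factors[R [S [bR bS -> _]]]; exists R, S.
Qed.

Section OneIdeal.
Variable I : set (X -> X).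
Hypothesis ideal_I : closed_ideal I.

Let I_comp T U V : I T -> bounded_ops X X U -> bounded_ops X X V ->
  I (U \o T \o V).
Proof. by case: ideal_I => _ _ h _; exact: h. Qed.

(** The operator is [U T V], where [V] maps into the multiples of some [x0] with [T x0] non-zero and
    [U] sends [T x0] to [y]. The functional behind [U] is evaluation at a point where [T x0] attains
    its norm. *)
Lemma rank_one_in_ideal (T : X -> X) (psi : X -> F^o) (y : X) :
  I T -> T <> 0 -> bounded_ops X F^o psi -> I (fun x => psi x *: y).
Proof.
move=> IT T0 /bounded_opsP[p [-> [C C0 pC]]].
have [x0 Tx0] : exists x, T x != 0.
  apply: contrapT => h; apply: T0; apply/funext => x; apply/eqP/negPn/negP => Tx.
  by apply: h; exists x.
have [t Tt] := CK_norm_attained Tx0; pose c := val (T x0) t.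
have cn0 : c != 0 by rewrite -normr_gt0 -Tt normr_gt0.
pose U (z : X) := (c^-1 * val z t) *: y; pose V x := p x *: x0.
have bU : bounded_ops X X U.
  apply: (@bounded_opsI _ _ _ _ (`|c^-1| * `|y|)) => [a u v||x].
  - rewrite /U -[val (_ + _) t]/(a * val u t + val v t).
    by rewrite mulrDr scalerDl mulrCA scalerA.
  - exact: mulr_ge0.
  - by rewrite normrZ normrM mulrAC ler_wpM2l ?mulr_ge0// CK_norm_ge.
have bV : bounded_ops X X V.
  apply: (@bounded_opsI _ _ _ _ (C * `|x0|)) => [a u v||x].
  - by rewrite /V linearP scalerDl scalerA.
  - by rewrite mulr_ge0// ltW.
  - by rewrite normrZ mulrAC ler_wpM2r.
have := I_comp IT bU bV; congr (I _); apply/funext => x /=.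
have [lT _] : bounded_ops X X T by case: ideal_I => h _ _ _; exact: h.
have [f fE] := linear_bundle lT.
rewrite /U /V fE linearZ -fE -[val (_ *: _) t]/(p x * c).
by rewrite mulrCA mulVf ?mulr1.
Qed.

(** The tails [u - trunc n u] are bounded by the norm of [u] and tend to 0, hence do so uniformly on
    totally bounded sets; thus the finite-rank operators [S trunc N J] approximate [R] on the unit
    ball. *)
Lemma compact_in_ideal (T : X -> X) : I T -> T <> 0 -> compact_ops X `<=` I.
Proof.
move=> IT T0 R cR; have [bR tR] := (compact_opsP discs _).1 cR.
have [J [S [bJ bS RE [C C0 JR]]]] :=
  separable_range_factors (compact_ops_separable arch discs cR).
have [I_bounded [I0 ID IZ] _ I_closed] := ideal_I.
have fin n : I (S \o trunc n \o J).
  have [s sE] := bounded_ops_linear bS.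
  have -> : S \o trunc n \o J =
      \sum_(k < n) (fun x => (val (J x) k : F) *: S (unit_vec F k)).
    apply/funext => x; rewrite fct_sumE /= trunc_sum sE linear_sum.
    by apply: eq_bigr => k _; rewrite linearZ.
  elim/big_ind: _ => // k _.
  apply: (rank_one_in_ideal (psi := fun x => val (J x) k) _ IT T0).
  exact: bounded_ops_comp (bounded_coordinate F k) bJ.
have [s sE] := bounded_ops_linear bS; have [CS CS0 SC] := bounded_ops_bound bS.
have [j jE] := bounded_ops_linear bJ.
apply: I_closed => // e e0.
have e2 : 0 < e / CS / 2 by rewrite !divr_gt0.
(* The net lies in the image of the ball, so each of its points is some [R z] with a vector [J z] to
   truncate. *)
have [t [tin tP]] := totally_bounded_inner tR (divr_gt0 e2 C0).
have [N NP] : exists N, forall x, R x \in t -> `|J x - trunc N (J x)| < e / CS / 2.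
  have : exists N, forall n, (N <= n)%N -> forall x, R x \in t ->
      `|J x - trunc n (J x)| < e / CS / 2.
    elim: t {tin tP} => [|y t [N NP]]; first by exists 0%N => n _ x; rewrite in_nil.
    have [[x0 Rx0]|h] := pselect (exists x, R x = y); last first.
      exists N => n Nn x; rewrite inE => /predU1P[xy|]; last exact: NP.
      by case: h; exists x.
    have [M MP] := trunc_cvg (J x0) e2; exists (maxn N M) => n.
    rewrite geq_max => /andP[Nn Mn] x; rewrite inE => /predU1P[xy|]; last exact: NP.
    (* [R x] determines [J x], so one threshold per net point suffices. *)
    suff -> : J x = J x0 by exact: MP.
    apply/eqP; rewrite -subr_eq0 -normr_eq0 eq_le normr_ge0 andbT.
    by rewrite (le_trans (JR _ _))// xy Rx0 subrr normr0 mulr0.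
  by case=> N NP; exists N; exact: NP.
have ball x : `|x| <= 1 -> `|R x - (S \o trunc N \o J) x| <= e.
  move=> x1; have [|y yt xy] := tP (R x); first by exists x.
  have [z /= z1 zy] := tin _ yt.
  have Jxz : `|J x - J z| <= e / CS / 2.
    rewrite (le_trans (JR _ _))// zy mulrC -ler_pdivlMr//; exact: ltW.
  rewrite RE /= sE -linearB -sE (le_trans (SC _))// mulrC -ler_pdivlMr//.
  have [tr trE] := bounded_ops_linear (bounded_trunc F N).
  have -> : J x - trunc N (J x) =
      (J x - J z - trunc N (J x - J z)) + (J z - trunc N (J z)).
    rewrite trE linearB; set a := J x; set b := J z.
    by rewrite opprB addrACA subrK addrAC subrr add0r.
  rewrite (le_trans (ler_normD _ _))// [leRHS]splitr lerD//.
    exact: le_trans (trunc_tail_norm _ _) _.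
  by rewrite ltW// NP// zy.
exists (S \o trunc N \o J) => // x.
have [r rE] := bounded_ops_linear bR.
have [q qE] := bounded_ops_linear (I_bounded _ (fin N)).
have [->|x0] := eqVneq x 0.
  by rewrite rE qE !linear0 addr0 !normr0 mulr0.
have nx : 0 < `|x| by rewrite normr_gt0.
have := ball (`|x|^-1 *: x); rewrite normrZ normfV normr_id mulVf ?gt_eqF//.
move=> /(_ (lexx _)); rewrite rE qE !linearZ /= -scalerDr normrZ normfV normr_id.
by rewrite mulrC ler_pdivrMr.
Qed.

(** Inserting the approximate identity [V T U] of c_0 into [R = S J] gives [S V T U J], which lies
    in the ideal and differs from [R] by at most [e] in norm. *)
Lemma separable_in_ideal (T : X -> X) : I T -> ~ compact_ops X T ->
  separable_range_ops X `<=` I.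
Proof.
move=> IT nT R /separable_range_factors[J [S [bJ bS RE _]]].
have [I_bounded _ _ I_closed] := ideal_I; have bT := I_bounded _ IT.
have bR : bounded_ops X X R by rewrite RE; exact: bounded_ops_comp.
apply: I_closed => // e e0.
have [CJ CJ0 JC] := bounded_ops_bound bJ; have [CS CS0 SC] := bounded_ops_bound bS.
have e1 : 0 < e / CS / CJ by rewrite !divr_gt0.
have [U [V [bU bV UV]]] := noncompact_fixes_c0 bT nT e1.
exists ((S \o V) \o T \o (U \o J)); first by apply: I_comp => //; exact: bounded_ops_comp.
move=> x; have [s sE] := bounded_ops_linear bS.
rewrite RE /= sE -linearB -sE (le_trans (SC _))// distrC.
rewrite mulrC -ler_pdivlMr// (le_trans (UV _))// mulrAC ler_pdivrMr//.
have -> : e * `|x| / CS * CJ = e / CS * (CJ * `|x|) by ring.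
by rewrite ler_pM2l ?divr_gt0.
Qed.

End OneIdeal.

(** Applied to the zero subspace, [separable_in_c0] provides a copy of c_0 in [X], whose unit
    vectors are separated. *)
Lemma id_noncompact : ~ compact_ops X id.
Proof.
move=> /(compact_opsP discs)[_ tb].
have [E E0] := range_subspaceP (bounded_ops0 X X).1.
have [|W _ [j [s [bj bs sj js]]]] := @separable_in_c0 E.
  rewrite E0; apply/separableP => //; exists (fun=> 0) => _ [x _ <-] e e0.
  by exists 0%N; rewrite subrr normr0.
have [C C0 jC] := bounded_ops_bound bj; have [D D0 sD] := bounded_ops_bound bs.
have [f fE] := bounded_ops_linear bj; have [g gE] := bounded_ops_linear bs.
have d0 : 0 < D^-1 / C by rewrite divr_gt0 ?invr_gt0.
apply: (totally_bounded_separated d0 tb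
  (x := fun k => D^-1 *: (val (s (unit_vec F k)) : X))) => [n|m n mn].
  exists (D^-1 *: (val (s (unit_vec F n)) : X)) => //=.
  rewrite normrZ gtr0_norm ?invr_gt0// mulrC ler_pdivrMr// mul1r.
  rewrite (le_trans (sD _))// ler_piMr ?unit_vec_norm_le//; exact: ltW.
rewrite -scalerBr normrZ gtr0_norm ?invr_gt0// ltr_pM2l ?invr_gt0//.
rewrite -(ltr_pM2l C0) divff ?gt_eqF//; apply/negP; rewrite le_gtF//.
have nm : n <> m by move=> nm; rewrite nm ltnn in mn.
apply: le_trans (unit_vec_norm_dist F nm) _.
by rewrite -{1}(js (unit_vec F n)) -{1}(js (unit_vec F m)) fE -linearB -fE jC.
Qed.

(** For an approximate factorization [V U] of the identity of c_0, the operator [U V] factors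
    through c_0. If it were compact, so would be [V (U V) U], the square of [V U], which separates
    the unit vectors. *)
Lemma compact_proper_separable : compact_ops X `<` separable_range_ops X.
Proof.
split; first by move=> S; exact: compact_ops_separable.
move=> sub; have e0 : 0 < (4%:R : F)^-1 by rewrite invr_gt0 ltr0n.
have [U [V [bU bV VU]]] := noncompact_fixes_c0 (bounded_ops_id X) id_noncompact e0.
have /(compact_opsP discs)[_ tb] : compact_ops X (U \o V).
  by apply: sub; rewrite separable_range_opsE; exists V, U.
have {tb} := totally_bounded_image bV tb.
have [C C0 UC] := bounded_ops_bound bU.
have [u uE] := bounded_ops_linear bU; have [v vE] := bounded_ops_linear bV.
have VU_ge w : 3%:R / 4%:R * `|w| <= `|V (U w)|.
  have h : `|w| <= `|V (U w) - w| + `|V (U w)|.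
    by rewrite distrC -{1}(subrK (V (U w)) w) ler_normD.
  have {h} := le_trans h (lerD (VU w) (lexx _)); rewrite -lerBlDl.
  by apply: le_trans; have -> : `|w| - 4%:R^-1 * `|w| = 3%:R / 4%:R * `|w| by field.
(* The square of [V U] is bounded below by 9/16, which exceeds 1/2; [C] only scales the vectors into
   the unit ball. *)
move=> tb; have d0 : 0 < C^-1 / 2 by rewrite divr_gt0 ?invr_gt0.
apply: (totally_bounded_separated d0 tb
  (x := fun k => C^-1 *: V (U (V (U (unit_vec F k)))))) => [n|m n mn].
  exists (C^-1 *: U (V (U (unit_vec F n)))).
    exists (C^-1 *: U (unit_vec F n)) => /=; last by rewrite uE vE !linearZ.
    rewrite normrZ gtr0_norm ?invr_gt0// mulrC ler_pdivrMr// mul1r.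
    rewrite (le_trans (UC _))// ler_piMr ?unit_vec_norm_le//; exact: ltW.
  by rewrite vE linearZ.
rewrite -scalerBr normrZ gtr0_norm ?invr_gt0// ltr_pM2l ?invr_gt0//.
rewrite uE vE -!linearB -uE -vE => h.
have : (2 : F)^-1 < 2^-1; last by rewrite ltxx.
apply: le_lt_trans h; set w := _ - _.
rewrite (le_trans _ (VU_ge _))//.
apply: (@le_trans _ _ (3%:R / 4%:R * (3%:R / 4%:R))); last first.
  rewrite ler_pM2l ?divr_gt0 ?ltr0n// (le_trans _ (VU_ge _))//.
  rewrite ler_peMr ?divr_ge0 ?ler0n// unit_vec_norm_dist//.
  by move=> nm; rewrite nm ltnn in mn.
rewrite -subr_ge0 (_ : _ - _ = 16%:R^-1) ?invr_ge0 ?ler0n//; by field.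
Qed.

End Ideals.

(** * The points of a Mrowka space *)

Section StoneSpaces.
Variables (T : Type) (B : set (set T)).
Hypothesis algebra_B : boolean_subalgebra B.

(** An ultrafilter containing the finitely many sets of a basic neighbourhood contains their
    intersection, so a single member of [B] suffices. *)
Lemma stone_nbhs (u : stone_space B) (N : set (stone_space B)) : nbhs u N ->
  exists b, [/\ B b, sval u b & forall v : stone_space B, sval v b -> N v].
Proof.
rewrite nbhsE => -[V [[D' D'B <-] [i D'i /= iu]] VN].
have [E EB Ei] := D'B _ D'i.
have [b [Bb ub bE]] : exists b, [/\ B b, sval u b & forall c, c \in enum_fset E -> b `<=` c].
  have : forall c, c \in enum_fset E -> B c /\ sval u c.
    move=> c cE; move: iu; rewrite -Ei => /(_ c cE) uc; split=> //.
    exact: uf_sub (svalP u) _ uc.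
  elim: (enum_fset E) => [_|c s IH h].
    exists setT; split=> //; first by case: algebra_B.
    exact: uf_setT (svalP u).
  have [|b [Bb ub bs]] := IH; first by move=> d ds; apply: h; rewrite inE ds orbT.
  have [Bc uc] := h c (mem_head _ _).
  exists (c `&` b); split; [by case: algebra_B => _ h' _; exact: h'| |].
    exact: uf_setI (svalP u) _ _ uc ub.
  move=> d; rewrite inE => /predU1P[->|/bs bd]; first by move=> x [].
  by move=> x [_] /bd.
exists b; split=> // v vb; apply: VN; exists i => //; rewrite -Ei => c /= cE.
have [Bc _] : B c /\ True.
  by split=> //; move: iu; rewrite -Ei => /(_ c cE) /(uf_sub (svalP u)).
exact: uf_up (svalP v) _ _ vb Bc (bE _ cE).
Qed.

Lemma stone_open_nbhs (u : stone_space B) b : B b -> sval u b ->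
  nbhs u [set v : stone_space B | sval v b].
Proof.
move=> Bb ub; rewrite nbhsE.
exists [set v : stone_space B | sval v b] => //; split=> //.
exists [set [set v : stone_space B | sval v b]]; last by rewrite bigcup_set1.
move=> _ ->; exists ([fset b]%fset).
  by move=> c; rewrite in_fset1 => /eqP ->; exact/mem_set.
by apply/seteqP; split=> v /= h; [apply: h; rewrite /= in_fset1|move=> c; rewrite /= in_fset1 => /eqP ->].
Qed.

End StoneSpaces.

Section MrowkaPoints.
Variable A : set (set nat).
Local Notation G := (A `|` finite_set).
Local Notation B := (smallest (@boolean_subalgebra nat) G).

Lemma mrowka_algebra : boolean_subalgebra B.
Proof.
split=> [C [[]]//|a c Ba Bc C CG|a Ba C CG].
  by case: (CG) => -[_ h _] _; apply: h; [exact: Ba|exact: Bc].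
by case: (CG) => -[_ _ h] _; apply: h; exact: Ba.
Qed.

(* A proper filter on nat that decides every generator decides the whole
   Boolean algebra, so its trace is a point of the Stone space. *)
Lemma filter_point (H : set (set nat)) : H setT -> ~ H set0 ->
  (forall a c, H a -> H c -> H (a `&` c)) ->
  (forall a c, H a -> a `<=` c -> H c) ->
  (forall g, G g -> H g \/ H (~` g)) ->
  exists u : mrowka_space A, forall b, B b -> (sval u b <-> H b).
Proof.
move=> HT H0 HI HS HG.
have dec b : B b -> H b \/ H (~` b).
  apply: (@smallest_sub _ (@boolean_subalgebra nat) _ [set b | H b \/ H (~` b)]) => //.
  split=> [|a c [Ha|Ha] [Hc|Hc]|a [Ha|Ha]]; try by left.
  - by left; exact: HI.
  - by right; apply: HS Hc _; move=> x nx [].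
  - by right; apply: HS Ha _; move=> x nx [].
  - by right; apply: HS Ha _; move=> x nx [].
  - by right; rewrite /= setCK.
have uu : ultrafilter_of B [set b | B b /\ H b].
  have [BT BI BC] := mrowka_algebra; split.
  - by move=> b [].
  - by [].
  - by move=> [].
  - by move=> a c [Ba Ha] [Bc Hc]; split; [exact: BI|exact: HI].
  - by move=> a c [Ba Ha] Bc ac; split=> //; exact: HS ac.
  - by move=> a Ba; case: (dec _ Ba) => h; [left|right]; split=> //; exact: BC.
by exists (exist _ _ uu : mrowka_space A) => b Bb; split=> [[]|].
Qed.

Hypothesis A_ad : almost_disjoint A.

Lemma finite_set_ub (a : set nat) : finite_set a ->
  exists N, forall x, a x -> (x < N)%N.
Proof.
move=> /finite_seqP[s ->]; exists (\max_(x <- s) x).+1 => x /= xs.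
by rewrite ltnS; exact: leq_bigmax_seq.
Qed.

Lemma bounded_finite_set (a : set nat) N : (forall x, a x -> (x < N)%N) -> finite_set a.
Proof. by move=> aN; apply: (sub_finite_set _ (finite_II N)). Qed.

(** Inclusion up to a finite set. *)
Definition almost_sub (a b : set nat) :=
  exists N, forall x, (N <= x)%N -> a x -> b x.

Lemma almost_subI (a b c : set nat) :
  almost_sub a b -> almost_sub a c -> almost_sub a (b `&` c).
Proof.
move=> [N aN] [M aM]; exists (maxn N M) => x.
by rewrite geq_max => /andP[Nx Mx] ax; split; [exact: aN|exact: aM].
Qed.

Lemma almost_subS (a b c : set nat) : almost_sub a b -> b `<=` c -> almost_sub a c.
Proof. by move=> [N aN] bc; exists N => x Nx /(aN _ Nx) /bc. Qed.

Lemma almost_sub_set0 a : A a -> ~ almost_sub a set0.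
Proof.
move=> Aa [N aN]; apply: A_ad.1 Aa _; apply: (@bounded_finite_set _ N) => x ax.
by rewrite ltnNge; apply/negP => /aN/(_ ax).
Qed.

Lemma almost_sub_generator a g : A a -> G g -> g <> a -> almost_sub a (~` g).
Proof.
move=> Aa [Ag|fg] ga; [have /finite_set_ub[N NP] := A_ad.2 _ _ Aa Ag (nesym ga)|have [N NP] := finite_set_ub fg].
  by exists N => x Nx ax gx; have := NP _ (conj ax gx); rewrite ltnNge Nx.
by exists N => x Nx ax /NP; rewrite ltnNge Nx.
Qed.

Lemma mrowka_pointn (n : nat) :
  exists u : mrowka_space A, forall b, B b -> (sval u b <-> b n).
Proof.
apply: (@filter_point (fun b => b n)) => // [a c an ac|g _]; first exact: ac.
by have [|] := pselect (g n); [left|right].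
Qed.

(** The limit point of [a]: almost disjointness makes every other generator meet [a] in a finite
    set. *)
Lemma mrowka_pointA (a : set nat) : A a ->
  exists u : mrowka_space A, forall b, B b -> (sval u b <-> almost_sub a b).
Proof.
move=> Aa; apply: filter_point.
- by exists 0%N.
- exact: almost_sub_set0.
- exact: almost_subI.
- exact: almost_subS.
- move=> g Gg; have [->|ga] := pselect (g = a); first by left; exists 0%N.
  by right; exact: almost_sub_generator.
Qed.

Lemma subsequence_in (t : nat -> nat) (a : set nat) :
  (forall N, exists2 k, (N <= k)%N & a (t k)) ->
  exists phi : nat -> nat, (forall k, (phi k < phi k.+1)%N) /\
    forall k, a (t (phi k)).
Proof.
move=> h; have /choice[g gP] : forall N, exists k, (N <= k)%N /\ a (t k).
  by move=> N; have [k] := h N; exists k.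
exists (fun k => iter k (fun n => g n.+1) (g 0%N)); split=> [k|k] /=.
  by have [] := gP (iter k (fun n => g n.+1) (g 0%N)).+1.
by case: k => [|k] /=; [have [] := gP 0%N|have [] := gP (iter k (fun n => g n.+1) (g 0%N)).+1].
Qed.

(** If some member of [A] contains infinitely many terms, a subsequence inside it meets every other
    member finitely often; otherwise the sequence itself leaves every member. Either way the sets
    containing almost all terms form a filter that decides the generators. *)
Lemma mrowka_subsequence (t : nat -> nat) : (forall k, (t k < t k.+1)%N) ->
  exists (phi : nat -> nat) (u : mrowka_space A),
    (forall k, (phi k < phi k.+1)%N) /\ forall b, B b -> sval u b ->
      exists N, forall k, (N <= k)%N -> b (t (phi k)).
Proof.
move=> tlt.
have [phi [philt phiA]] : exists phi, (forall k, (phi k < phi k.+1)%N) /\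
    forall a, A a -> (exists N, forall k, (N <= k)%N -> a (t (phi k))) \/
                     (exists N, forall k, (N <= k)%N -> ~ a (t (phi k))).
  have [[a [Aa ta]]|h] := pselect (exists a, A a /\
      forall N, exists2 k, (N <= k)%N & a (t k)).
    have [phi [philt phia]] := subsequence_in ta.
    exists phi; split=> // c Ac; have [->|ca] := pselect (c = a).
      by left; exists 0%N.
    right; have /finite_set_ub[N NP] := A_ad.2 _ _ Ac Aa ca; exists N => k Nk ck.
    have := NP _ (conj ck (phia k)); rewrite ltnNge; case/negP.
    by rewrite (leq_trans Nk)// (leq_trans (incr_ge philt _))// incr_ge.
  exists id; split=> // a Aa; right; apply: contrapT => h'; apply: h; exists a.
  split=> // N; apply: contrapT => h; apply: h'; exists N => k Nk ak.
  by apply: h; exists k.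
pose H (b : set nat) := exists N, forall k, (N <= k)%N -> b (t (phi k)).
have [|||||u uP] := @filter_point H.
- by exists 0%N.
- by move=> [N /(_ N (leqnn N))].
- move=> a c [N aN] [M aM]; exists (maxn N M) => k.
  by rewrite geq_max => /andP[Nk Mk]; split; [exact: aN|exact: aM].
- by move=> a c [N aN] ac; exists N => k /aN /ac.
- move=> g [/phiA[]|fg]; [by left|by right|right].
  have [N NP] := finite_set_ub fg; exists N => k Nk /NP; rewrite ltnNge.
  by rewrite (leq_trans Nk)// (leq_trans (incr_ge philt _))// incr_ge.
by exists phi, u; split=> // b Bb /(uP _ Bb).
Qed.

Hypothesis A_uncountable : ~ countable A.

Lemma countableU (T : Type) (C D : set T) :
  countable C -> countable D -> countable (C `|` D).
Proof.
move=> cC cD; rewrite -bigcup2E; apply: bigcup_countable => // i _.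
by case: i => [|[|i]] //=.
Qed.

(** A generator almost contains at most one generating member of [A], itself, unless it is finite
    and contains none, so its complement almost contains all but countably many members;
    uncountability of [A] makes the filter proper. *)
Lemma mrowka_infinity : exists w : mrowka_space A, forall b, B b ->
  (sval w b <-> countable [set a | A a /\ ~ almost_sub a b]).
Proof.
apply: filter_point.
- suff -> : [set a | A a /\ ~ almost_sub a setT] = set0 by [].
  by apply/seteqP; split=> a //= [_]; apply; exists 0%N.
- move=> c0; apply: A_uncountable; apply: sub_countable c0; apply: subset_card_le.
  by move=> a Aa; split=> //; exact: almost_sub_set0.
- move=> b c cb cc; apply: sub_countable (countableU cb cc).
  apply: subset_card_le => a [Aa nbc].
  have [ab|nb] := pselect (almost_sub a b); last by left.
  by right; split=> // ac; apply: nbc; exact: almost_subI.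
- move=> b c cb bc; apply: sub_countable cb; apply: subset_card_le => a [Aa nc].
  by split=> // ab; apply: nc; exact: almost_subS bc.
- move=> g Gg; right; apply: sub_countable (countable1 g); apply: subset_card_le.
  move=> a [Aa ng]; apply: contrapT => /= ag; apply: ng.
  by apply: almost_sub_generator => // ga; apply: ag.
Qed.

Lemma locally_constant_continuous (K : topologicalType) (F : numFieldType)
    (g : K -> F^o) : (forall v, nbhs v [set x | g x = g v]) -> continuous g.
Proof.
move=> h v; apply/cvgrPdist_lt => e e0; apply: filterS (h v) => x /= ->.
by rewrite subrr normr0.
Qed.

Section Functions.
Variable F : numFieldType.
Hypothesis arch : archimedean_norm F.
Local Notation X := (CK (mrowka_space A) F).

Lemma mrowka_function_nbhs (f : X) (u : mrowka_space A) (e : F) : 0 < e ->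
  exists b, [/\ B b, sval u b &
    forall v : mrowka_space A, sval v b -> `|val f u - val f v| < e].
Proof.
move=> e0; have /cvgrPdist_lt /(_ _ e0) := @CK_cont _ _ f u.
exact: stone_nbhs mrowka_algebra _ _.
Qed.

(** The points are the traces of the principal ultrafilters. A basic neighbourhood is given by a
    non-empty set [b], and the point of any [n] in [b] lies in it. *)
Lemma mrowka_norming_subsequences : exists pts : nat -> mrowka_space A,
  norming F pts /\ subsequentially_convergent F pts.
Proof.
have /choice[pts ptsP] := mrowka_pointn; exists pts; split=> [f c fc|t tlt].
  have c0 : 0 <= c by exact: le_trans (fc 0%N).
  apply: CK_norm_le => // v; rewrite real_leNgt ?normr_real ?ger0_real//.
  apply/negP => cv; have e0 : 0 < `|val f v| - c by rewrite subr_gt0.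
  have [b [Bb vb bP]] := mrowka_function_nbhs f v e0.
  have [b0|/eqP/set0P[n bn]] := pselect (b = set0).
    by move: vb; rewrite b0; exact: uf_set0 (svalP v).
  have := bP _ ((ptsP n _ Bb).2 bn); apply/negP; rewrite le_gtF//.
  rewrite lerBlDr (le_trans _ (lerD (lexx _) (fc n)))//.
  by rewrite -{1}(subrK (val f (pts n)) (val f v)) ler_normD.
have [phi [u [philt uP]]] := mrowka_subsequence tlt; exists phi, u; split=> // f e e0.
have [b [Bb ub bP]] := mrowka_function_nbhs f u e0.
have [N NP] := uP _ Bb ub; exists N => k Nk; rewrite distrC; apply: bP.
by apply/ptsP => //; exact: NP.
Qed.

(** Each [d n] is within [m.+1%:R^-1] of its value at [w] on some set belonging to [w], which almost
    contains all but countably many members of [A]. Countably many such conditions leave a member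
    [a], whose limit point [p] the [d n] do not distinguish from [w]; the indicator of [a] does. *)
Lemma mrowka_not_countably_separated : exists w : mrowka_space A,
  forall d : nat -> X, exists (p : mrowka_space A) (g : X),
    (forall n, val (d n) p = val (d n) w) /\ val g p <> val g w.
Proof.
have [w wP] := mrowka_infinity; exists w => d.
have /choice[b bP] : forall i : nat * nat, exists b, [/\ B b, sval w b &
    forall v : mrowka_space A, sval v b ->
      `|val (d i.1) w - val (d i.1) v| < i.2.+1%:R^-1].
  by move=> i; apply: mrowka_function_nbhs; rewrite invr_gt0.
have cbad : countable (\bigcup_i [set a | A a /\ ~ almost_sub a (b i)]).
  apply: bigcup_countable => // i _; have [Bb wb _] := bP i.
  exact/(wP _ Bb).
have [a Aa ab] : exists2 a, A a & forall i, almost_sub a (b i).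
  apply: contrapT => h; apply: A_uncountable; apply: sub_countable cbad.
  apply: subset_card_le => a Aa; apply: contrapT => nbad; apply: h; exists a => // i.
  by apply: contrapT => nab; apply: nbad; exists i.
have [p pP] := mrowka_pointA Aa.
have [_ _ BC] := mrowka_algebra.
have Ba : B a by apply: sub_gen_smallest; left.
have [g gE] : exists g : X, val g = (fun v => if `[< sval v a >] then 1 else 0).
  apply: CKI; apply: (@locally_constant_continuous (mrowka_space A)) => v.
  have [va|nva] := pselect (sval v a).
    apply: (@filterS _ _ (@nbhs_filter (mrowka_space A) v) _ _ _ (stone_open_nbhs Ba va)).
    by move=> x xa; rewrite /= (asboolT va) (asboolT (xa : sval x a)).
  have vca : sval v (~` a) by have [|] := uf_ultra (svalP v) Ba.
  apply: (@filterS _ _ (@nbhs_filter (mrowka_space A) v) _ _ _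
    (stone_open_nbhs (BC _ Ba) vca)) => x xca.
  have nxa : ~ sval x a.
    move=> xa; have := uf_setI (svalP x) xa xca; rewrite setICr.
    exact: uf_set0 (svalP x).
  by rewrite /= (asboolF nva) (asboolF nxa).
exists p, g; split=> [n|].
  apply/esym/eqP; rewrite -subr_eq0 -normr_eq0.
  have [//|/eqP] := eqVneq `|val (d n) w - val (d n) p| 0 => /eqP ne.
  have pos : 0 < `|val (d n) w - val (d n) p| by rewrite lt_neqAle eq_sym ne normr_ge0.
  have [m mP] := archi_inv_lt arch pos; have [Bb _ bd] := bP (n, m).
  have := bd p ((pP _ Bb).2 (ab _)).
  by move=> /(lt_trans mP); rewrite ltxx.
have pa : sval p a by apply/(pP _ Ba); exists 0%N.
(* Otherwise all but countably many members would be almost contained in [a], whereas a second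
   member meets [a] in a finite set. *)
have nwa : ~ sval w a.
  move=> /(wP _ Ba) ca; apply: A_uncountable.
  apply: sub_countable (countableU (countable1 a) ca); apply: subset_card_le.
  move=> c Ac; have [->|ca'] := pselect (c = a); [by left|right; split=> // sca].
  apply: (almost_sub_set0 Ac); rewrite -(setICr a).
  apply: almost_subI => //; apply: almost_sub_generator => //; first by left.
  exact: nesym.
by rewrite gE (asboolT pa) (asboolF nwa) => /eqP; rewrite oner_eq0.
Qed.

End Functions.

End MrowkaPoints.

(** * Weakly compactly generated subspaces *)

Section WeakTopology.
Variables (F : numFieldType) (V : normedModType F).

(** An ultrafilter on this set contains the singleton of a term or avoids every finite part of the
    sequence; in the latter case it converges to 0. *)
Lemma null_sequence_compact (x : nat -> V) :
  (forall e : F, 0 < e -> exists N, forall n, (N <= n)%N -> `|x n| < e) ->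
  compact ([set 0] `|` range x).
Proof.
move=> x0; rewrite compact_ultra => G GU GS.
have [[n Gn]|nG] := pselect (exists n, G [set x n]).
  exists (x n); split; first by right; exists n.
  by move=> N /nbhs_singleton Nx; apply: filterS Gn => _ ->.
exists 0; split; first by left.
have avoid m : G [set y | forall n, (n < m)%N -> y <> x n].
  elim: m => [|m IH]; first by apply: filterS filterT.
  have [Gm|Gm] := in_ultra_setVsetC [set x m] GU; first by case: nG; exists m.
  apply: filterS (filterI IH Gm) => y [yx ym] n.
  by rewrite ltnS leq_eqVlt => /predU1P[->|/yx].
move=> N /nbhs_ballP[e /= e0 eN]; have [M xM] := x0 _ e0.
apply: filterS (filterI GS (avoid M)) => y [[->|[n _ <-]] yM]; apply: eN.
  exact: ballxx.
rewrite -ball_normE /ball_ /= sub0r normrN; apply: xM.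
by rewrite leqNgt; apply/negP => nM; exact: yM nM _.
Qed.

Lemma weak_topology_continuous_id :
  continuous (id : V -> weak_topology V).
Proof.
apply: continuous_comp_initial => x; apply/cvg_sup => phi.
move: x; apply: continuous_comp_initial => x.
by have [_ h] := svalP phi; exact: h.
Qed.

Lemma compact_weakly_compact (A : set V) : compact A -> weakly_compact A.
Proof.
move=> cA; rewrite /weakly_compact -[A]image_id.
apply: (@continuous_compact V (weak_topology V) id) => //.
by apply: continuous_subspaceT; exact: weak_topology_continuous_id.
Qed.

Lemma weak_topology_functional_continuous (phi : dual V) :
  continuous (sval phi : weak_topology V -> F^o).
Proof.
move=> x N Nx.
pose ev (y : weak_topology V) : prod_topology (fun _ : dual V => F^o) :=
  fun psi => sval psi y.
have cev : ev @ nbhs x --> ev x by apply: initial_continuous.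
have /cvg_sup/(_ phi) h := cev.
exact: (h _ (@initial_continuous _ _ (fun p : dual V -> F^o => p phi) (ev x) N Nx)).
Qed.

Lemma cluster_functional (g : nat -> V) (x : V) (phi : dual V) (l : F) :
  cluster ((g : nat -> weak_topology V) @ \oo) x ->
  null_seq (fun k => sval phi (g k) - l) -> sval phi x = l.
Proof.
move=> gx gl; apply/eqP; rewrite -subr_eq0 -normr_eq0.
have [//|/eqP xl] := eqVneq `|sval phi x - l| 0.
have pos : 0 < `|sval phi x - l| by rewrite lt_neqAle eq_sym normr_ge0 andbT; apply/eqP.
have e2 : 0 < `|sval phi x - l| / 2 by exact: divr_gt0.
have [N gN] := gl _ e2.
have /cvgrPdist_lt /(_ _ e2) nx := @weak_topology_functional_continuous phi x.
have [|y [[k Nk <-] /= xk]] := gx (g @` [set k | (N <= k)%N]) _ _ nx.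
  by exists N => // k Nk; exists k.
have := ltrD xk (gN k Nk); rewrite -splitr => /(le_lt_trans (ler_normD _ _)).
by rewrite addrA subrK ltxx.
Qed.

End WeakTopology.

Section WeaklyCompactlyGenerated.
Variables (F : numFieldType) (K : compactSpaceType).
Hypothesis arch : archimedean_norm F.
Hypothesis discs : compact_discs F.
Local Notation X := (CK K F).

Lemma closure_subspaceP (V : normedModType F) (E : linear_subspace V) :
  exists W : linear_subspace V, (W : set V) = closure E.
Proof.
have W0 : closure E 0 by apply: subset_closure; exact: subspace0.
have WP (a : F) x y : closure E x -> closure E y -> closure E (a *: x + y).
  move=> /closureP Ex /closureP Ey; apply/closureP => e e0.
  have a1 : 0 < `|a| + 1 by rewrite ltr_wpDl.
  have e2 : 0 < e / 2 by exact: divr_gt0.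
  have [x' Ex' xx] := Ex _ (divr_gt0 e2 a1); have [y' Ey' yy] := Ey _ e2.
  exists (a *: x' + y'); first exact: subspaceP.
  rewrite opprD addrACA -scalerBr (le_lt_trans (ler_normD _ _))// [ltRHS]splitr.
  apply: ltrD yy; rewrite normrZ.
  apply: (@le_lt_trans _ _ ((`|a| + 1) * `|x - x'|)).
    by rewrite ler_wpM2r// lerDl.
  by rewrite mulrC -ltr_pdivlMr.
by exists (Subspace W0 WP).
Qed.

(** A dense sequence is rescaled to a null sequence, which together with 0 is norm compact, hence
    weakly compact, and has dense span. *)
Lemma separable_wcg (W : linear_subspace X) : seq_dense (W : set X) ->
  weakly_compactly_generated (subspace_space W).
Proof.
move=> /(seq_dense_inner arch (subspace0 W))[d [Wd dP]].
pose y n : subspace_space W := mem_subspace (Wd n).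
pose c n : F := n.+1%:R * (1 + `|y n|).
have c0 n : 0 < c n by rewrite mulr_gt0 ?ltr0n// ltr_pwDl.
pose z n := (c n)^-1 *: y n.
exists ([set 0] `|` range z); split.
  apply: compact_weakly_compact; apply: null_sequence_compact => e e0.
  have [N Ne] := archi_inv_lt arch e0; exists N => n Nn.
  apply: le_lt_trans Ne; rewrite /z normrZ gtr0_norm ?invr_gt0// mulrC.
  rewrite ler_pdivrMr// /c mulrA; apply: (@le_trans _ _ (1 + `|y n|)).
    by rewrite lerDr.
  by rewrite ler_peMl ?addr_ge0// mulrC ler_pdivlMr ?ltr0n// mul1r ler_nat ltnS.
move=> O [x Ox] oO; have /nbhs_ballP[e /= e0 eO] : nbhs x O by exact: open_nbhs_nbhs.
have [n xn] := dP _ (subspaceW x) _ e0; exists (y n); split.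
  by apply: eO; rewrite -ball_normE.
exists 1%N, (fun=> c n), (fun=> z n); split; first by move=> _; right; exists n.
by rewrite big_ord1 /z scalerA divff ?scale1r// gt_eqF.
Qed.

Lemma separable_range_wcg (T : X -> X) : separable_range_ops X T -> wcg_ops X T.
Proof.
move=> /(separable_range_opsP arch)[bT sT]; split=> //.
have [E ER] := range_subspaceP bT.1; have [W WE] := closure_subspaceP E.
exists W; rewrite WE ER; split; [exact: closed_closure|exact: subset_closure|].
by apply: separable_wcg; rewrite WE ER; exact: seq_dense_closure.
Qed.

Variable pts : nat -> K.
Hypothesis pts_norming : norming F pts.

(* On a weakly compact set the weak topology is determined by the countably
   many evaluations at the points pts n, hence the set is weakly separable. *)
Lemma weakly_compact_countably_determined (W : linear_subspace X)
    (L : set (subspace_space W)) : weakly_compact L ->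
  exists d : nat -> X, forall s t : K, (forall n, val (d n) s = val (d n) t) ->
    forall f, L f -> val (val f : X) s = val (val f : X) t.
Proof.
move=> cL; have [q qd] := scalars_seq_dense arch discs.
(* A list [s] codes approximate values at the first [size s] points; [d s] is a member of [L]
   realizing them, or 0 if there is none. *)
pose ok (s : seq nat) (f : subspace_space W) :=
  L f /\ forall i, (i < size s)%N ->
    `|val (val f : X) (pts i) - q (nth 0%N s i)| < (size s).+1%:R^-1.
pose d (s : seq nat) : subspace_space W := xget 0 (ok s).
exists (fun n => if @unpickle (seq nat) n is Some s then val (d s) else 0).
move=> s t dst f Lf.
have {}dst r : val (val (d r) : X) s = val (val (d r) : X) t.
  by have := dst (pickle r); rewrite pickleK.
have /choice[r rP] : forall k, exists r : seq nat, size r = k /\ ok r f.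
  move=> k; have k0 : 0 < k.+1%:R^-1 :> F by rewrite invr_gt0 ltr0n.
  have [r [rk rf]] := seq_approx qd (fun i => val (val f : X) (pts i)) k k0.
  by exists r; split=> //; split=> //; rewrite rk.
pose g k := d (r k).
have gok k : ok (r k) (g k).
  by rewrite /g /d; case: xgetP => [//|/(_ f)[]]; exact: (rP k).2.
have bev u : bounded_ops (subspace_space W) F^o (fun h => val (val h : X) u).
  exact: bounded_ops_comp (bounded_evaluation _ u) (bounded_subspace_val W).
(* The [g k] converge to [f] at every [pts i], so a weak cluster point agrees with [f] at these
   points and equals [f]. *)
have [|x [Lx gx]] := cL ((g : nat -> weak_topology (subspace_space W)) @ \oo) _.
  by exists 0%N => // k _; have [] := gok k.
have xf i : val (val x : X) (pts i) = val (val f : X) (pts i).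
  apply: (cluster_functional (phi := exist _ _ (bev (pts i))) gx) => e e0 /=.
  have e2 : 0 < e / 2 by exact: divr_gt0.
  have [m me] := archi_inv_lt arch e2; exists (maxn i.+1 m) => k.
  rewrite geq_max => /andP[ik mk]; have [_ gk] := gok k; have [rk [_ fk]] := rP k.
  have {}me : k.+1%:R^-1 < e / 2.
    by apply: le_lt_trans me; rewrite lef_pV2 ?posrE ?ltr0n// ler_nat ltnS.
  rewrite rk in gk fk.
  rewrite (le_lt_trans (ler_distD (q (nth 0%N (r k) i)) _ _))// [ltRHS]splitr.
  by rewrite ltrD// ?(distrC (q _)) (lt_trans _ me)// ?gk ?fk.
have <- : x = f.
  apply: val_inj; apply/eqP; rewrite -subr_eq0 -normr_le0; apply: pts_norming => i.
  by rewrite -[val _ _]/(val (val x : X) (pts i) - val (val f : X) (pts i)) xf subrr normr0.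
(* The difference of the evaluations at [s] and [t] vanishes on all [g k], hence at their cluster
   point. *)
have bst : bounded_ops (subspace_space W) F^o
    (fun h => val (val h : X) s - val (val h : X) t).
  have := bounded_opsD (bev s) (bounded_opsZ (-1) (bev t)).
  by congr bounded_ops; apply/funext => h /=; rewrite !fctE scaleN1r.
apply/eqP; rewrite -subr_eq0; apply/eqP.
apply: (cluster_functional (phi := exist _ _ bst) gx) => e e0.
by exists 0%N => k _; rewrite /= dst subrr subr0 normr0.
Qed.

Hypothesis not_separated : exists w : K, forall d : nat -> X,
  exists (p : K) (g : X),
    (forall n, val (d n) p = val (d n) w) /\ val g p <> val g w.

Lemma agree_limit (p w : K) (x : X) :
  (forall e : F, 0 < e -> exists y : X, val y p = val y w /\ `|x - y| < e) ->
  val x p = val x w.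
Proof.
move=> h; apply/eqP; rewrite -subr_eq0 -normr_eq0.
have [//|/eqP xl] := eqVneq `|val x p - val x w| 0.
have pos : 0 < `|val x p - val x w| by rewrite lt_neqAle eq_sym normr_ge0 andbT; apply/eqP.
have e2 : 0 < `|val x p - val x w| / 2 by exact: divr_gt0.
have [y [ypw xy]] := h _ e2.
have hp : `|val x p - val y p| < `|val x p - val x w| / 2.
  by rewrite (le_lt_trans _ xy)// -[leLHS]/(`|val (x - y) p|) CK_norm_ge.
have hw : `|val y w - val x w| < `|val x p - val x w| / 2.
  by rewrite distrC (le_lt_trans _ xy)// -[leLHS]/(`|val (x - y) w|) CK_norm_ge.
have := le_lt_trans (ler_normD _ _) (ltrD hp hw).
by rewrite -splitr ypw addrA subrK ltxx.
Qed.

(** Countably many functions control the values at [p] and [w] on [W] and on the range of [S]. If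
    they agree at both points, so do [T g] and [S g], hence [a *: g], although [g] separates the
    two. *)
Lemma scalar_plus_separable_not_wcg (T S : X -> X) (a : F) : a != 0 ->
  separable_range_ops X S -> (forall x, T x = a *: x + S x) -> ~ wcg_ops X T.
Proof.
move=> a0 /(separable_range_opsP arch)[_ [s sP]] TE [bT [W [_ TW [L [wL dL]]]]].
have [d dP] := weakly_compact_countably_determined wL.
have [w wP] := not_separated.
(* Both sequences are interleaved, so that one point [p] serves for [W] and for the range of [S]. *)
have [p [g [dpw]]] := wP (fun n => if odd n then s n./2 else d n./2); apply.
have spw n : val (s n) p = val (s n) w.
  by have := dpw n.*2.+1; rewrite /= odd_double uphalf_double.
have {}dP f : L f -> val (val f : X) p = val (val f : X) w.
  by apply: dP => n; have := dpw n.*2; rewrite odd_double doubleK.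
have Wpw x : subspace_set W x -> val x p = val x w.
  move=> Wx; apply: agree_limit => e e0.
  have [||y [xy [n [b [v [vL yE]]]]]] := dL (ball (mem_subspace Wx) e).
  - by exists (mem_subspace Wx); exact: ballxx.
  - exact: ball_open.
  exists (val y); split; last by move: xy; rewrite -ball_normE.
  have bev u : bounded_ops (subspace_space W) F^o (fun h => val (val h : X) u).
    exact: bounded_ops_comp (bounded_evaluation _ u) (bounded_subspace_val W).
  have [f fE] := bounded_ops_linear (bev p); have [h hE] := bounded_ops_linear (bev w).
  have fp z : val (val z : X) p = f z by rewrite -fE.
  have hw z : val (val z : X) w = h z by rewrite -hE.
  rewrite fp hw yE !linear_sum; apply: eq_bigr => i _.
  by rewrite !linearZ /= -fp -hw dP.
have Spw : val (S g) p = val (S g) w.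
  apply: agree_limit => e e0; have [|n sn] := sP (S g) _ _ e0; first by exists g.
  by exists (s n).
have Tpw : val (T g) p = val (T g) w by apply: Wpw; apply: TW; exists g.
move: Tpw; rewrite TE.
rewrite -[val _ p]/(a * val g p + val (S g) p) -[val _ w]/(a * val g w + val (S g) w).
by rewrite Spw => /addIr/(mulfI a0).
Qed.

End WeaklyCompactlyGenerated.

(** * Operators as scalar multiples of the identity plus separable range *)

Section Codimension.
Variables (F : numFieldType) (K : compactSpaceType).
Hypothesis arch : archimedean_norm F.
Local Notation X := (CK K F).
Hypothesis X_codim1 : codimension_one (separable_range_ops X).

Lemma id_not_separable : ~ separable_range_ops X id.
Proof.
move=> idS; have [U [bU nU _]] := X_codim1; apply: nU.
have [_ _ h _] := closed_ideal_separable K arch.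
exact: (h id U id idS bU (bounded_ops_id X)).
Qed.

(** [U] is exchanged for the identity: modulo separable range [id] is [b *: U], with [b] non-zero
    because [id] is not in the ideal. *)
Lemma codimension_decomposition (T : X -> X) : bounded_ops X X T ->
  exists a : F, separable_range_ops X (T - a *: id).
Proof.
move=> bT; have [U [bU nU UP]] := X_codim1.
have [_ [S0 SD SZ] _ _] := closed_ideal_separable K arch.
have [b bS] := UP _ (bounded_ops_id X); have [c cS] := UP _ bT.
have b0 : b != 0.
  apply/eqP => b0; apply: id_not_separable; move: bS; rewrite b0.
  by rewrite scale0r subr0.
exists (c / b); have := SD _ _ cS (SZ (- (c / b)) _ bS).
by rewrite scalerBr !scaleNr opprK scalerA divfK// [- _ + _]addrC addrA subrK.
Qed.

End Codimension.

(** * The lattice of closed ideals *)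

Section Classification.
Variables (F : numFieldType) (K : compactSpaceType).
Hypothesis arch : archimedean_norm F.
Hypothesis discs : compact_discs F.
Local Notation X := (CK K F).
Variable pts : nat -> K.
Hypothesis pts_norming : norming F pts.
Hypothesis pts_subseq : subsequentially_convergent F pts.
Hypothesis separable_in_c0 : forall E : linear_subspace X,
  separable (E : set X) ->
  exists2 W : linear_subspace X, E `<=` W & isomorphic (subspace_space W) (c0 F).
Hypothesis X_codim1 : codimension_one (separable_range_ops X).
Hypothesis not_separated : exists w : K, forall d : nat -> X,
  exists (p : K) (g : X),
    (forall n, val (d n) p = val (d n) w) /\ val g p <> val g w.

Lemma zero_proper_compact : [set (0 : X -> X)] `<` compact_ops X.
Proof.
split; first by move=> _ ->; have [_ []] := closed_ideal_compact K discs.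
have [u uE] : exists u : X, val u = (fun=> 1).
  by apply: CKI => t; exact: cvg_cst.
(* A rank-one operator onto the constants, non-zero at the constant [u]. *)
pose T (f : X) : X := val f (pts 0%N) *: u.
have bT : bounded_ops X X T.
  apply: (@bounded_opsI _ _ _ _ `|u|) => // [a f g|f].
    rewrite /T -[val (_ + _) _]/(a * val f (pts 0%N) + val g (pts 0%N)).
    by rewrite scalerDl scalerA.
  by rewrite normrZ mulrC ler_wpM2l// CK_norm_ge.
have cT : compact_ops X T.
  apply/(compact_opsP discs); split=> //.
  apply: totally_bounded_sub (totally_bounded_disc_scale discs 1 u).
  move=> _ [f /= f1 <-]; exists (val f (pts 0%N)) => //=.
  exact: le_trans (CK_norm_ge _ _) f1.
move=> /(_ _ cT) /= T0; have := congr1 (fun S => val (S u) (pts 0%N)) T0.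
rewrite /T -[LHS]/(val u (pts 0%N) * val u (pts 0%N)) uE mulr1 => /eqP.
by rewrite oner_eq0.
Qed.

Lemma wcg_opsE : wcg_ops X = separable_range_ops X.
Proof.
apply/seteqP; split=> T wT; last exact: separable_range_wcg.
have [bT _] := wT; have [a Sa] := codimension_decomposition arch X_codim1 bT.
have [a0|a0] := eqVneq a 0; first by move: Sa; rewrite a0 scale0r subr0.
have nT := scalar_plus_separable_not_wcg arch discs pts_norming not_separated a0 Sa.
case: (nT T) => // x.
by rewrite -[(T - a *: id) x]/(T x - a *: x) addrC subrK.
Qed.

Lemma separable_proper : separable_range_ops X `<` bounded_ops X X.
Proof.
split=> [T []//|h]; apply: (id_not_separable arch X_codim1); apply: h.
exact: bounded_ops_id.
Qed.

(** The chain is climbed: an element of [I] outside one of the ideals forces the next one into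
    [I]. *)
Lemma closed_ideal_classification (I : set (X -> X)) : closed_ideal I <->
  [\/ I = [set (0 : X -> X)], I = compact_ops X,
      I = separable_range_ops X | I = bounded_ops X X].
Proof.
split=> [idI|[] ->]; last 4 first.
- exact: closed_ideal_zero.
- exact: closed_ideal_compact.
- exact: closed_ideal_separable.
- exact: closed_ideal_all.
have [I_bounded [I0 ID IZ] I_comp _] := idI.
have [[T [IT T0]]|all0] := pselect (exists T, I T /\ T <> 0); last first.
  apply: Or41; apply/seteqP; split=> [T IT|_ ->//].
  by apply: contrapT => T0; apply: all0; exists T.
have KI := compact_in_ideal arch discs separable_in_c0 idI IT T0.
have [IK|/existsNP[R /not_implyP[IR nR]]] := pselect (I `<=` compact_ops X).
  by apply: Or42; apply/seteqP; split.
have SI := separable_in_ideal arch discs pts_norming pts_subseq separable_in_c0 idI IR nR.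
have [IS|/existsNP[S /not_implyP[IS nS]]] := pselect (I `<=` separable_range_ops X).
  by apply: Or43; apply/seteqP; split.
apply: Or44; apply/seteqP; split=> // U bU.
have [a Sa] := codimension_decomposition arch X_codim1 (I_bounded _ IS).
have a0 : a != 0.
  by apply/eqP => a0; apply: nS; move: Sa; rewrite a0 scale0r subr0.
(* The identity is recovered as [a^-1 *: (S - (S - a *: id))]. *)
have Iid : I id.
  have := IZ a^-1 _ (ID _ _ IS (IZ (-1) _ (SI _ Sa))).
  by rewrite scaleN1r opprB addrC subrK scalerA mulVf// scale1r.
exact: (I_comp id U id Iid bU (bounded_ops_id X)).
Qed.

End Classification.

Lemma real_or_complex_archimedean (F : numFieldType) :
  real_or_complex F -> archimedean_norm F.
Proof. by case=> R; [exact: archimedean_realType|exact: archimedean_complex]. Qed.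

Lemma real_or_complex_compact_discs (F : numFieldType) :
  real_or_complex F -> compact_discs F.
Proof. by case=> R; [exact: compact_discs_realType|exact: compact_discs_complex]. Qed.

Unset Implicit Arguments.

Theorem theorem5p5 (F : numFieldType) (scalars : real_or_complex F)
    (A : set (set nat)) (uncountable_A : ~ countable A)
    (almost_disjoint_A : almost_disjoint A) :
  let X : normedModType F := CK (mrowka_space A) F in
  forall (X_codim1 : codimension_one (separable_range_ops X))
    (separable_in_c0 : forall E : linear_subspace X, separable (E : set X) ->
       exists2 W : linear_subspace X, E `<=` W & isomorphic (subspace_space W) (c0 F))
    (decompositions : forall Y Z : linear_subspace X,
       closed (Y : set X) -> closed (Z : set X) -> direct_sum Y Z ->
       infinite_dimensional (subspace_space Y) ->
       infinite_dimensional (subspace_space Z) ->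
       (isomorphic (subspace_space Y) (c0 F) /\ isomorphic (subspace_space Z) X) \/
       (isomorphic (subspace_space Z) (c0 F) /\ isomorphic (subspace_space Y) X)),
  [/\ [set (0 : X -> X)] `<` compact_ops X,
      compact_ops X `<` separable_range_ops X,
      separable_range_ops X = c0_factoring_ops X,
      c0_factoring_ops X = wcg_ops X &
      wcg_ops X `<` bounded_ops X X] /\
  (forall I : set (X -> X), closed_ideal I <->
     [\/ I = [set (0 : X -> X)], I = compact_ops X,
         I = separable_range_ops X | I = bounded_ops X X]).
Proof.
move=> X X_codim1 separable_in_c0 _.
have arch := real_or_complex_archimedean scalars.
have discs := real_or_complex_compact_discs scalars.
have [pts [pts_norming pts_subseq]] := mrowka_norming_subsequences almost_disjoint_A F.
have not_sep := mrowka_not_countably_separated almost_disjoint_A uncountable_A arch.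
have SE := separable_range_opsE arch discs separable_in_c0.
have WE := wcg_opsE arch discs pts_norming X_codim1 not_sep.
split; last exact: (closed_ideal_classification arch discs pts_norming).
split.
- exact: zero_proper_compact discs pts.
- exact (compact_proper_separable arch discs pts_norming pts_subseq separable_in_c0).
- exact: SE.
- by rewrite -SE; exact: esym WE.
- by rewrite WE; exact: separable_proper arch X_codim1.
Qed.
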